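(* Let $X, Y$ be Banach spaces with $X$ reflexive, $\Omega\subseteq X$ an open set, $F:\Omega\to Y$ a continuously Fréchet differentiable function, $C\subset Y$ a nonempty closed convex cone, $R>0$ and $f:[0,R)\to\mathbb{R}$ a continuously differentiable function. Suppose that $\tilde{x}\in\Omega$, that $F$ satisfies Robinson's condition at $\tilde{x}$ (i.e. $\mathrm{rge}\,T_{\tilde{x}}=Y$), that $f$ is a majorant function for $F$ at $\tilde{x}$, and that $$\|T_{\tilde{x}}^{-1}(-F(\tilde{x}))\|\le f(0).$$ Then $f$ has a smallest zero $t_*\in(0,R)$, and the sequences generated by Newton's method for solving the inclusion $F(x)\in C$ and the equation $f(t)=0$, with starting points $x_0=\tilde{x}$ and $t_0=0$ respectively, $$x_{k+1}\in x_k+\mathrm{argmin}\{\|d\| : d\in X,\ F(x_k)+F'(x_k)d\in C\},\qquad t_{k+1}=t_k-\frac{f(t_k)}{f'(t_k)},\qquad k=0,1,\ldots,$$ are well defined; $\{x_k\}$ is contained in $B(\tilde{x},t_* )$; $\{t_k\}$ is strictly increasing, is contained in $[0,t_* )$ and converges to $t_*$; and $$\|x_{k+1}-x_k\|\le t_{k+1}-t_k\quad (k=0,1,\ldots),\qquad \|x_{k+1}-x_k\|\le\frac{t_{k+1}-t_k}{(t_k-t_{k-1})^2}\|x_k-x_{k-1}\|^2\quad (k=1,2,\ldots).$$ Moreover, $\{x_k\}$ converges to some $x_*\in B[\tilde{x},t_*]$ such that $F(x_* )\in C$, $$\|x_*-x_k\|\le t_*-t_k,\qquad t_*-t_{k+1}\le\tfrac12(t_*-t_k),\qquad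 k=0,1,\ldots,$$ and therefore $\{t_k\}$ converges $Q$-linearly to $t_*$ and $\{x_k\}$ converges $R$-linearly to $x_*$. If, additionally, $f(t)<0$ for some $t\in(0,R)$, then $$\|x_{k+1}-x_k\|\le\frac{D^-f'(t_* )}{-2f'(t_* )}\|x_k-x_{k-1}\|^2,\qquad t_{k+1}-t_k\le\frac{D^-f'(t_* )}{-2f'(t_* )}(t_k-t_{k-1})^2,\qquad k=1,2,\ldots,$$ and, as a consequence, $\{x_k\}$ and $\{t_k\}$ converge $Q$-quadratically to $x_*$ and $t_*$, respectively, in the sense that $$\limsup_{k\to\infty}\frac{\|x_*-x_{k+1}\|}{\|x_*-x_k\|^2}\le\frac{D^-f'(t_* )}{-2f'(t_* )},\qquad t_*-t_{k+1}\le\frac{D^-f'(t_* )}{-2f'(t_* )}(t_*-t_k)^2,\quad k=0,1,\ldots.$$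
   Context: $B(x,\delta)$ and $B[x,\delta]$ are the open and closed balls. For $z\in\Omega$, $T_z:X\rightrightarrows Y$ is the set-valued map $T_zd=F'(z)d-C$, and $T_z^{-1}:Y\rightrightarrows X$ is its inverse, $T_z^{-1}y=\{d\in X: F'(z)d-y\in C\}$. $\mathrm{rge}\,T_z=\bigcup_{d\in X}T_zd$. For a set-valued map $S$ between Banach spaces, $\mathrm{dom}\,S=\{d: Sd\ne\varnothing\}$, $\|Sd\|:=\inf\{\|v\|: v\in Sd\}$ (with $\|Sd\|=+\infty$ if $Sd=\varnothing$), and $\|S\|:=\sup\{\|Sd\|: d\in\mathrm{dom}\,S,\ \|d\|\le1\}$. For a linear map $A:X\to Y$, $T_z^{-1}A$ is the composition $d\mapsto T_z^{-1}(Ad)$. A continuously differentiable $f:[0,R)\to\mathbb{R}$ is a majorant function for $F$ at $\tilde{x}\in\Omega$ if $B(\tilde{x},R)\subseteq\Omega$, $$\|T_{\tilde{x}}^{-1}[F'(y)-F'(x)]\|\le f'(\|y-x\|+\|x-\tilde{x}\|)-f'(\|x-\tilde{x}\|)$$ for all $x,y\in B(\tilde{x},R)$ with $\|x-\tilde{x}\|+\|y-x\|<R$, and: (h1) $f(0)>0$, $f'(0)=-1$; (h2) $f'$ is convex and strictly increasing; (h3) $f(t)=0$ for some $t\in(0,R)$. $D^-\varphi(s_0)=\lim_{s\to s_0^-}\frac{\varphi(s_0)-\varphi(s)}{s_0-s}$ is the left derivative of a convex function. The sequence $\{x_k\}$ is any sequence obtained by choosing at each step an element of the (possibly multi-element)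 argmin set; ''well defined'' means that each $x_k\in\Omega$ and every argmin set is nonempty, and $f'(t_k)\neq0$ for all $k$. In the limsup, a quotient $0/0$ is read as $0$. *)

(* Defs.v *)
From HB Require Import structures.
From mathcomp Require Import all_boot all_order all_algebra.
From mathcomp Require Import all_classical all_reals all_analysis.

Set Implicit Arguments.
Unset Strict Implicit.
Unset Printing Implicit Defensive.

Import Order.TTheory GRing.Theory Num.Theory.
Import numFieldNormedType.Exports.

Local Open Scope classical_set_scope.
Local Open Scope ring_scope.

(* Operator norm, valued in the extended reals so that it is meaningful (+oo)
   for unbounded maps as well. *)
Definition opnorm (R : realType) (X Y : normedModType R) (A : X -> Y) : \bar R :=
  ereal_sup [set `|A d|%:E | d in [set d : X | `|d| <= 1]].

Definition dual (R : realType) (X : normedModType R) : set (X -> R^o) :=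
  [set u | linear u /\ continuous u].

(* The topological dual has no normed module structure in the library, so a
   bidual element is a map on functions of which only the values on [dual X]
   matter. *)
Definition bidual (R : realType) (X : normedModType R) : set ((X -> R^o) -> R) :=
  [set Phi |
    (forall (a : R) (u v : X -> R^o), dual u -> dual v ->
       Phi (fun x => a * u x + v x) = a * Phi u + Phi v) /\
    (exists M : R, forall u : X -> R^o, dual u ->
       (`|Phi u|%:E <= M%:E * opnorm u)%E)].

Definition reflexive_space (R : realType) (X : normedModType R) : Prop :=
  forall Phi, @bidual R X Phi -> exists x : X, forall u, dual u -> Phi u = u x.

(* A map F : Omega -> Y is represented by a total function of which only the
   values on the open set Omega matter. *)
Definition C1_Frechet (R : realType) (X Y : normedModType R) (Omega : set X)
    (F : X -> Y) : Prop :=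
  forall x, Omega x -> differentiable F x /\
    opnorm (fun d => 'd F y d - 'd F x d) @[y --> x] --> 0%E.

Definition cone (R : realType) (Y : normedModType R) (C : set Y) : Prop :=
  forall (a : R) (y : Y), 0 < a -> C y -> C (a *: y).

(* Set-valued maps from U to V are functions U -> set V. *)
Definition sv_inv (U V : Type) (S : U -> set V) : V -> set U :=
  fun v => [set u | S u v].

Definition sv_rge (U V : Type) (S : U -> set V) : set V := \bigcup_u S u.

Definition sv_dom (U V : Type) (S : U -> set V) : set U :=
  [set u | S u !=set0].

(* [ereal_inf set0] is +oo. *)
Definition set_norm (R : realType) (V : normedModType R) (A : set V) : \bar R :=
  ereal_inf [set `|v|%:E | v in A].

Definition sv_norm (R : realType) (U V : normedModType R) (S : U -> set V) :
    \bar R :=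
  ereal_sup [set set_norm (S d) | d in [set d | sv_dom S d /\ `|d| <= 1]].

Definition Tmap (R : realType) (X Y : normedModType R) (F : X -> Y) (C : set Y)
    (z : X) : X -> set Y :=
  fun d => [set 'd F z d - c | c in C].

Lemma Tmap_invE (R : realType) (X Y : normedModType R) (F : X -> Y) (C : set Y)
    (z : X) (y : Y) :
  sv_inv (Tmap F C z) y = [set d | C ('d F z d - y)].
Proof.
apply/seteqP; split=> d /=; first by move=> [c Cc <-]; rewrite opprB addrC subrK.
by move=> Cd; exists ('d F z d - y) => //; rewrite opprB addrC subrK.
Qed.

(* Derivative relative to a domain D: the variable of the difference quotient
   stays in D, hence a one-sided derivative at an endpoint of an interval. *)
Definition derivative_in (R : realType) (D : set R) (f : R -> R) (t : R) : R :=
  lim ((f s - f t) / (s - t) @[s --> within D t^']).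

Definition C1_in (R : realType) (D : set R) (f : R -> R) : Prop :=
  (forall t, D t -> cvg ((f s - f t) / (s - t) @[s --> within D t^'])) /\
  {within D, continuous (derivative_in D f)}.

Definition left_derivative (R : realType) (phi : R -> R) (s0 : R) : R :=
  lim ((phi s0 - phi s) / (s0 - s) @[s --> s0^'-]).

(* The derivative of a function f : [0, r) -> R, represented by a total
   function of which only the values on [0, r) matter. *)
Notation deriv_upto r f := (derivative_in `[0, r[%classic f).

Definition majorant (R : realType) (X Y : normedModType R) (Omega : set X)
    (F : X -> Y) (C : set Y) (r : R) (f : R -> R) (xt : X) : Prop :=
  let f' := deriv_upto r f in
  [/\ C1_in `[0, r[%classic f,
      ball xt r `<=` Omega &
      forall x y : X, ball xt r x -> ball xt r y ->
        `|x - xt| + `|y - x| < r ->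
        (sv_norm (sv_inv (Tmap F C xt) \o (fun d => ('d F y d - 'd F x d)%R))
          <= (f' (`|y - x| + `|x - xt|) - f' `|x - xt|)%:E)%E]
  /\
  [/\ 0 < f 0 /\ f' 0 = -1,
      convex_function (`[0, r[%classic : set R) f' /\
        {in `[0, r[ &, {homo f' : s t / s < t}} &
      exists2 t, 0 < t < r & f t = 0].

Definition newton_argmin (R : realType) (X Y : normedModType R) (F : X -> Y)
    (C : set Y) (z : X) : set X :=
  [set d | C (F z + 'd F z d) /\
     forall d' : X, C (F z + 'd F z d') -> `|d| <= `|d'|].

(* The first n steps of a run of the method, with arbitrary choices among the
   minimizers; only x 0, ..., x n matter. *)
Definition newton_run (R : realType) (X Y : normedModType R) (F : X -> Y)
    (C : set Y) (xt : X) (n : nat) (x : nat -> X) : Prop :=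
  x 0%N = xt /\
  forall k, (k < n)%N -> exists2 d, newton_argmin F C (x k) d & x k.+1 = x k + d.

Definition newton_seq (R : realType) (X Y : normedModType R) (F : X -> Y)
    (C : set Y) (xt : X) (x : nat -> X) : Prop :=
  x 0%N = xt /\
  forall k, exists2 d, newton_argmin F C (x k) d & x k.+1 = x k + d.

(* Whatever choices have been made so far, the current iterate lies in the
   domain of F and there is a minimizer to continue with. *)
Definition newton_well_defined (R : realType) (X Y : normedModType R)
    (Omega : set X) (F : X -> Y) (C : set Y) (xt : X) : Prop :=
  forall n x, newton_run F C xt n x ->
    Omega (x n) /\ newton_argmin F C (x n) !=set0.

Definition newton_t (R : realType) (r : R) (f : R -> R) (k : nat) : R :=
  iter k (fun t => t - f t / deriv_upto r f t) 0.

Definition Q_linear (R : realType) (V : normedModType R) (u : nat -> V) (l : V)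
    : Prop :=
  u @ \oo --> l /\
  exists2 c : R, 0 < c < 1 &
    \forall k \near \oo, `|l - u k.+1| <= c * `|l - u k|.

Definition R_linear (R : realType) (V : normedModType R) (u : nat -> V) (l : V)
    : Prop :=
  exists2 e : nat -> R^o, Q_linear e 0 & forall k, `|l - u k| <= e k.

(* Main.v *)
Require Import Defs.
From HB Require Import structures.
From mathcomp Require Import all_boot all_order all_algebra.
From mathcomp Require Import all_classical all_reals all_analysis.
From mathcomp Require Import ring lra.

(* By convex duality the Newton step is controlled by scalar quantities.  X
   being reflexive, the sets {A d - c : |d| <= m, c in C} are closed, so a
   solution d of A d - w in C with |d| <= m exists as soon as - u w <= m nu for
   every continuous functional u <= 0 on C and every bound nu of u o A.  For
   such u the majorant condition says that the derivative of u o F has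
   increments dominated by those of f'.  Hence the norm of u o F'(x) is at least
   - f'(t) times that of u o F'(xt) when |x - xt| <= t, and the linearization
   error of u o F is dominated by that of f.  Dividing, the minimal step at x_k
   is at most f(t_k) / - f'(t_k) = t_(k+1) - t_k, scaled by the square of
   |x_k - x_(k-1)| / (t_k - t_(k-1)).  The scalar sequence is handled by the
   trapezoidal bound f b - f a - f' a (b - a) <= (f' b - f' a) (b - a) / 2,
   which holds because f' is convex. *)

Set Implicit Arguments.
Unset Strict Implicit.
Unset Printing Implicit Defensive.

Import Order.TTheory GRing.Theory Num.Theory.
Import numFieldNormedType.Exports.

Local Open Scope classical_set_scope.
Local Open Scope ring_scope.

(** * Hahn-Banach separation *)

(** The obstacle is that [sv_inv (Tmap F C z)] is multivalued and only positively homogeneous, so a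
    perturbed derivative cannot be inverted by a Neumann series. A functional [u <= 0] on [C]
    reduces an inclusion [A d - w] in [C] to the inequality [u (A d) <= u w], where linear estimates
    apply. The way back, from all these inequalities to an actual [d], is separation, and it needs a
    closed set; this is where reflexivity enters. Quantifying over the bounds [nu] of [u o A], in
    place of taking its norm, keeps every estimate between real numbers. The majorant condition
    controls increments only relative to the norm of [u o F'(xt)], which is itself to be bounded.
    The estimate is therefore self-referential: this norm is at most that of [u o F'(x)] plus
    [f'(t) - f'(0)] times itself. It can be solved because [f'(0) = -1] and [f'(t) < 0] make that
    factor smaller than [1], and [1] minus the factor is [- f'(t)]. *)

Definition sublinear (R : realType) (V : lmodType R) (p : V -> R) :=
  (forall x y, p (x + y) <= p x + p y) /\
  (forall a x, 0 < a -> p (a *: x) <= a * p x).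

Section Sublinear.
Context {R : realType} {V : lmodType R}.
Implicit Types p q : V -> R.

Lemma sublinear0 p : sublinear p -> p 0 = 0.
Proof.
move=> [_ ph]; have := ph 2 0; have := ph 2^-1 0.
rewrite !scaler0 invr_gt0 ltr0n => /(_ isT) h1 /(_ isT) h2; lra.
Qed.

(** The factor [a^-1] gives the reverse inequality. The definition asks only for [<=] because that
    is what an infimum yields directly. *)
Lemma sublinear_gt0Z p a x : sublinear p -> 0 < a -> p (a *: x) = a * p x.
Proof.
move=> [_ ph] a0; apply/eqP; rewrite eq_le ph//=.
have := ph a^-1 (a *: x); rewrite invr_gt0 => /(_ a0).
by rewrite scalerA mulVf ?gt_eqF// scale1r ler_pdivlMl.
Qed.

Lemma sublinearN_le p x : sublinear p -> - p (- x) <= p x.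
Proof.
move=> ps; have := ps.1 x (- x); rewrite subrr sublinear0//; lra.
Qed.

(** Provides the bound of a chain for Zorn's lemma. Subadditivity uses the chain: of two members
    nearly minimal at [x] and at [y], the smaller one serves both points. *)
Lemma inf_sublinear_chain p (A : set (V -> R)) :
  A !=set0 -> (forall q, A q -> sublinear q) ->
  (forall q1 q2, A q1 -> A q2 ->
    (forall x, q1 x <= q2 x) \/ (forall x, q2 x <= q1 x)) ->
  (forall x, exists m, forall q, A q -> m <= q x) ->
  sublinear (fun x => inf [set q x | q in A]) /\
  (forall q x, A q -> inf [set q x | q in A] <= q x).
Proof.
move=> [q0 Aq0] As Ac Alb.
have hi x : has_inf [set q x | q in A].
  split; first by exists (q0 x); exists q0.
  by have [m mP] := Alb x; exists m => _ [q Aq <-]; exact: mP.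
have lei q x : A q -> inf [set q x | q in A] <= q x.
  by move=> Aq; apply: ge_inf; [exact: (hi x).2 | exists q].
split=> //; split=> [x y|a x a0].
  apply/ler_addgt0Pr => e e0.
  have e20 : 0 < e / 2 by rewrite divr_gt0.
  have [_ [q1 Aq1 <-] h1] := inf_adherent e20 (hi x).
  have [_ [q2 Aq2 <-] h2] := inf_adherent e20 (hi y).
  have [le12|le21] := Ac _ _ Aq1 Aq2.
  - have := lei q1 (x + y) Aq1; have := (As _ Aq1).1 x y; have := le12 y; lra.
  - have := lei q2 (x + y) Aq2; have := (As _ Aq2).1 x y; have := le21 x; lra.
rewrite -ler_pdivrMl//; apply: lb_le_inf; first by exists (q0 x); exists q0.
move=> _ [q Aq <-]; rewrite ler_pdivrMl//.
by apply: le_trans (lei q _ Aq) _; exact: (As _ Aq).2.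
Qed.

(** Shifts add up: [t] for [x] and [s] for [y] give the candidate [t + s] for [x + y]. Each infimum
    is finite since [- q (- y)] bounds all shifts from below. The shift [0] gives [qz <= q], the
    shift [1] is the one used for additivity. *)
Lemma inf_sublinear_shift q z : sublinear q ->
  let qz y := inf [set q (y + t *: z) - t * q z | t in [set t | 0 <= t]] in
  sublinear qz /\ forall y t, 0 <= t -> qz y <= q (y + t *: z) - t * q z.
Proof.
move=> qs qz.
have hi y : has_inf [set q (y + t *: z) - t * q z | t in [set t | 0 <= t]].
  split; first by exists (q (y + 0 *: z) - 0 * q z); exists 0 => //=.
  exists (- q (- y)) => _ [t /= t0 <-].
  have := qs.1 (y + t *: z) (- y); rewrite addrC addrA addNr add0r.
  move: t0; rewrite [0 <= t]le_eqVlt => /predU1P[<-|t0].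
    by rewrite scale0r sublinear0// mul0r addr0; lra.
  by rewrite sublinear_gt0Z//; lra.
have lei y t : 0 <= t -> qz y <= q (y + t *: z) - t * q z.
  by move=> t0; apply: ge_inf; [exact: (hi y).2 | exists t].
split=> //; split=> [x y|a x a0].
  apply/ler_addgt0Pr => e e0.
  have e20 : 0 < e / 2 by rewrite divr_gt0.
  have [_ [t /= t0 <-] h1] := inf_adherent e20 (hi x).
  have [_ [s /= s0 <-] h2] := inf_adherent e20 (hi y).
  have := lei (x + y) (t + s) (addr_ge0 t0 s0).
  rewrite scalerDl addrACA; have := qs.1 (x + t *: z) (y + s *: z).
  by rewrite -/(qz x) -/(qz y) in h1 h2 *; lra.
rewrite -ler_pdivrMl//; apply: lb_le_inf.
  by exists (q (x + 0 *: z) - 0 * q z); exists 0 => //=.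
move=> _ [t /= t0 <-]; rewrite ler_pdivrMl// mulrBr mulrA.
have := lei (a *: x) (a * t).
rewrite -scalerA -scalerDr (sublinear_gt0Z _ qs)//.
by apply; rewrite mulr_ge0// ltW.
Qed.

(* A minimal sublinear functional q is linear: it equals its infimal shifts,
   so q y <= q (y + z) - q z. *)
Lemma sublinear_ge_linear p : sublinear p ->
  exists u : V -> R^o, linear u /\ forall x, u x <= p x.
Proof.
move=> ps; pose T := {q : V -> R | sublinear q /\ forall x, q x <= p x}.
(* The order is reversed, so that a maximal element is a minimal functional. *)
pose le (q1 q2 : T) := `[< forall x, sval q2 x <= sval q1 x >].
have [|||A Atot|q qmin] := @Zorn T le.
- by move=> q; apply/asboolP.
- move=> q1 q2 q3 /asboolP h1 /asboolP h2; apply/asboolP => x.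
  exact: le_trans (h2 x) (h1 x).
- move=> [q1 P1] [q2 P2] /asboolP/= h1 /asboolP/= h2; apply: eq_exist.
  by apply/funext => x; apply/eqP; rewrite eq_le h1 h2.
- have [->|/set0P[q0 Aq0]] := eqVneq A set0.
    by exists (exist _ p (conj ps (fun x => lexx _))).
  pose B := [set sval q | q in A].
  have [||||qs qle] := @inf_sublinear_chain p B.
  + by exists (sval q0); exists q0.
  + by move=> _ [[q [qs qp]] _ <-].
  + by move=> _ _ [q1 A1 <-] [q2 A2 <-];
      have [/asboolP|/asboolP] := Atot _ _ A1 A2; [right|left].
  + move=> x; exists (- p (- x)) => _ [[q [qs qp]] _ <-] /=.
    by have := sublinearN_le x qs; have := qp (- x); lra.
  unshelve eexists (exist _ (fun x => inf [set q x | q in B]) _).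
    split=> // x; apply: le_trans ((svalP q0).2 x).
    by apply: qle; exists q0.
  by move=> q Aq; apply/asboolP => x /=; apply: qle; exists q.
have [qs qp] := svalP q; have {}qmin q' : sublinear q' ->
    (forall x, q' x <= sval q x) -> q' = sval q.
  move=> q's q'q.
  have q'p x : q' x <= p x by exact: le_trans (q'q x) (qp x).
  by rewrite -(qmin (exist _ q' (conj q's q'p)))//; apply/asboolP.
move: {q} (sval q) qs qp qmin => q qs qp qmin.
have qD x y : q (x + y) = q x + q y.
  apply/eqP; rewrite eq_le qs.1/=.
  have [rs rle] := inf_sublinear_shift y qs.
  have := rle x 1 ler01; rewrite scale1r mul1r.
  suff -> : inf [set q (x + t *: y) - t * q y | t in [set t | 0 <= t]] = q x.
    by lra.
  move: x; apply/funeqP/qmin => // x.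
  by have := rle x 0 (lexx _); rewrite scale0r addr0 mul0r subr0.
have qN x : q (- x) = - q x.
  by apply/eqP; rewrite -subr_eq0 opprK -qD addNr sublinear0.
have qZ a x : q (a *: x) = a * q x.
  have [a0|a0|->] := ltgtP a 0.
  - by rewrite -[a]opprK scaleNr qN sublinear_gt0Z ?oppr_gt0// !mulNr.
  - exact: sublinear_gt0Z.
  - by rewrite scale0r mul0r sublinear0.
by exists q; split=> // a x y; rewrite qD qZ.
Qed.

End Sublinear.

(** * Convex sets, closures and bounded linear maps in normed spaces *)

Lemma convex_setP (R : realType) (V : lmodType R) (A : set V) :
  convex_set (A : set (convex_lmodType V)) <->
  forall x y a b, 0 <= a -> 0 <= b -> a + b = 1 -> A x -> A y ->
    A (a *: x + b *: y).
Proof.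
split=> [cA x y a b a0 b0 ab1 Ax Ay|cA x y t /set_mem Ax /set_mem Ay].
  have a1 : a <= 1 by rewrite -ab1 lerDl.
  have := cA x y (Itv01 a0 a1); rewrite !inE => /(_ Ax Ay).
  have -> // : b = 1 - a by rewrite -ab1 addrC addKr.
apply/mem_set; apply: cA => //; first by rewrite subr_ge0.
by rewrite addrC subrK.
Qed.

Lemma closure_normP (R : realType) (V : normedModType R) (A : set V) (x : V) :
  closure A x <-> forall e, 0 < e -> exists2 y, A y & `|x - y| < e.
Proof.
split=> [clx e e0|xA B /nbhs_normP[e /= e0 eB]].
  have [|y [Ay xy]] := clx [set y | `|x - y| < e]; last by exists y.
  by apply/nbhs_normP; exists e.
by have [y Ay xy] := xA e e0; exists y; split=> //; exact: eB.
Qed.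

Lemma closed_normP (R : realType) (V : normedModType R) (A : set V) (x : V) :
  closed A -> (forall e, 0 < e -> exists2 y, A y & `|x - y| < e) -> A x.
Proof. by move=> cA /closure_normP; exact: cA. Qed.

Section BoundedLinear.
Context {R : realType} {V W : normedModType R}.

Lemma linear_le_continuous (f : V -> W) (M : R) :
  linear f -> (forall x, `|f x| <= M * `|x|) -> continuous f.
Proof.
move=> lf fM.
pose lf' : {linear V -> W} := HB.pack f (GRing.isLinear.Build R V W *:%R f lf).
apply: (@bounded_linear_continuous _ _ _ lf').
apply/linear_boundedP; exists M; split; first exact: num_real.
move=> N MN x; apply: le_trans (fM x) _.
by rewrite ler_wpM2r// ltW.
Qed.

Lemma continuous_linear_le (f : V -> W) :
  linear f -> continuous f ->
  exists2 M : R, 0 < M & forall x, `|f x| <= M * `|x|.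
Proof.
move=> lf cf.
pose lf' : {linear V -> W} := HB.pack f (GRing.isLinear.Build R V W *:%R f lf).
have /linear_boundedP[M [_ fM]] : bounded_near lf' (nbhs (0 : V)).
  by apply: continuous_linear_bounded; exact: cf.
exists (Num.max M 0 + 1) => [|x]; first by rewrite ltr_wpDl// le_max lexx orbT.
apply: (fM (Num.max M 0 + 1)); rewrite ltr_pwDr// le_max lexx//.
Qed.

End BoundedLinear.

Section LinearFun.
Context {R : realType} {V W : lmodType R} (f : V -> W) (lf : linear f).

Lemma linfD x y : f (x + y) = f x + f y.
Proof. by rewrite -[x]scale1r lf !scale1r. Qed.

Lemma linf0 : f 0 = 0.
Proof. by apply: (addrI (f 0)); rewrite -linfD !addr0. Qed.

Lemma linfZ a x : f (a *: x) = a *: f x.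
Proof. by rewrite -[a *: x]addr0 lf linf0 addr0. Qed.

Lemma linfN x : f (- x) = - f x.
Proof. by rewrite -scaleN1r linfZ scaleN1r. Qed.

Lemma linfB x y : f (x - y) = f x - f y.
Proof. by rewrite linfD linfN. Qed.

End LinearFun.

(* Hahn-Banach applied to p y = inf (|y + t (k - w)| - t e), t >= 0, k in K,
   where e > 0 bounds the distance from w to K below: p is sublinear, p <= |.|, and
   p (w - k) <= - e. *)
Lemma convex_separation (R : realType) (V : normedModType R) (K : set V)
    (w : V) :
  closed K -> convex_set (K : set (convex_lmodType V)) -> ~ K w ->
  exists2 u : V -> R^o, dual u &
    exists2 e : R, 0 < e & forall k, K k -> u w + e <= u k.
Proof.
move=> cK /convex_setP xK nKw.
have [->|/set0P[k0 Kk0]] := eqVneq K set0.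
  exists (fun=> 0); last by exists 1.
  by split; [move=> a x y; rewrite scaler0 addr0 | exact: cst_continuous].
have [e e0 eK] : exists2 e : R, 0 < e & forall k, K k -> e <= `|k - w|.
  apply: contrapT => /forall2NP H; apply: nKw; apply: closed_normP cK _ => e e0.
  have [//|/existsNP[k /not_implyP[Kk /negP]]] := H e.
  by rewrite -ltNge distrC => ek; exists k.
pose S y := [set `|y + z.1 *: (z.2 - w)| - z.1 * e | 
    z in [set z : R * V | 0 <= z.1 /\ K z.2]].
pose p y := inf (S y).
have hi y : has_inf (S y).
  split.
    exists (`|y + 0 *: (k0 - w)| - 0 * e).
    by exists (0, k0).
  exists (- `|y|) => _ [[t k] /= [t0 Kk] <-].
  have := ler_normB (y + t *: (k - w)) y; rewrite addrAC subrr add0r.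
  rewrite normrZ (ger0_norm t0); have := ler_wpM2l t0 (eK k Kk); lra.
have lep y t k : 0 <= t -> K k -> p y <= `|y + t *: (k - w)| - t * e.
  by move=> t0 Kk; apply: ge_inf; [exact: (hi y).2 | exists (t, k)].
have ps : sublinear p.
  split=> [x y|a x a0].
    apply/ler_addgt0Pr => d d0.
    have d20 : 0 < d / 2 by rewrite divr_gt0.
    have [_ [[t k] /= [t0 Kk] <-] h1] := inf_adherent d20 (hi x).
    have [_ [[s l] /= [s0 Kl] <-] h2] := inf_adherent d20 (hi y).
    rewrite -/(p x) -/(p y) in h1 h2.
    have tri := ler_normD (x + t *: (k - w)) (y + s *: (l - w)).
    rewrite addrACA in tri.
    (* Two shifts merge into one of length [t + s] towards the convex combination with weights
       [t / (t + s)] and [s / (t + s)], so the case of two zero shifts stands apart. *)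
    have [ts0|ts0] := eqVneq (t + s) 0.
      have := lep (x + y) 0 k0 (lexx _) Kk0; rewrite scale0r.
      have [t00 s00] : t = 0 /\ s = 0 
        by move/eqP: ts0; rewrite paddr_eq0// => /andP[/eqP -> /eqP ->].
      by move: tri h1 h2; rewrite t00 s00 !scale0r !addr0; lra.
    have ts_gt0 : 0 < t + s by rewrite lt_neqAle eq_sym ts0 addr_ge0.
    have Kkl : K ((t / (t + s)) *: k + (s / (t + s)) *: l).
      by apply: xK => //; rewrite ?divr_ge0 ?addr_ge0// -mulrDl divff.
    have := lep (x + y) (t + s) _ (ltW ts_gt0) Kkl.
    have -> : (t + s) *: ((t / (t + s)) *: k + (s / (t + s)) *: l - w) =
        t *: (k - w) + s *: (l - w).
      rewrite !scalerBr scalerDr !scalerA ![(t + s) * _]mulrC !divfK//.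
      by rewrite scalerDl opprD addrACA.
    by lra.
  rewrite -ler_pdivrMl//; apply: lb_le_inf.
    by exists (`|x + 0 *: (k0 - w)| - 0 * e); exists (0, k0).
  move=> _ [[t k] /= [t0 Kk] <-]; rewrite ler_pdivrMl// mulrBr mulrA.
  have := lep (a *: x) (a * t) k (mulr_ge0 (ltW a0) t0) Kk.
  by rewrite -scalerA -scalerDr normrZ gtr0_norm.
have [u [lu up]] := sublinear_ge_linear ps.
have ple y : p y <= `|y|.
  by have := lep y 0 k0 (lexx _) Kk0; rewrite scale0r addr0 mul0r subr0.
exists u.
  split=> //; apply: (@linear_le_continuous _ _ _ _ 1) => // x.
  rewrite mul1r ler_norml; apply/andP; split; last first.
    exact: le_trans (up _) (ple _).
  by rewrite lerNl -linfN//; apply: le_trans (up _) _; rewrite -normrN.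
exists e => // k Kk; have := le_trans (up (w - k)) (lep (w - k) 1 k ler01 Kk).
rewrite linfB// scale1r mul1r -[w - k]opprB addNr normr0 => h.
by move: h; rewrite sub0r lerBlDr addrC lerBrDr.
Qed.

(** * Reflexive spaces and dual feasibility *)

(* The limit of the functionals along an ultrafilter refining G is an element
   of the bidual, hence a point of X; it lies in B by separation. *)
Lemma reflexive_filter_point (R : realType) (X : normedModType R)
    (G : set_system X) (M : R) :
  reflexive_space X -> ProperFilter G -> G [set x | `|x| <= M] ->
  exists x, forall B, closed B -> convex_set (B : set (convex_lmodType X)) ->
    G B -> B x.
Proof.
move=> Xrefl FG GM.
have [U [UU GU]] := ultraFilterLemma FG.
pose N := Num.max M 0 + 1.
have MN : M <= N by rewrite ler_wpDr// le_max lexx.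
have N0 : 0 < N by rewrite ltr_wpDl// le_max lexx orbT.
have UN : U [set x | `|x| <= N].
  by apply: filterS (GU _ GM) => x /= /le_trans; exact.
have ucvg (u : X -> R^o) : dual u -> cvg (u x @[x --> U]).
  move=> [lu cu]; have [L L0 uL] := continuous_linear_le lu cu.
  (* Along [U] the values of [u] stay in a compact segment and have a cluster point; for an
     ultrafilter a cluster point is a limit. *)
  have [|p [_ clp]] :=
      @segment_compact R (- (L * N)) (L * N) (u x @[x --> U]) _.
    apply: (@filterS _ U _ _ (u @^-1` `[- (L * N), L * N]) _ UN) => x /= xN.
    have : `|u x| <= L * N by apply: le_trans (uL x) _; rewrite ler_wpM2l// ltW.
    by rewrite in_itv/= ler_norml.
  apply/cvg_ex; exists p => A pA.
  have [//|UAc] := in_ultra_setVsetC (u @^-1` A) UU.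
  by have [y [yA Ay]] := clp (~` A) A UAc pA; case: yA.
pose Phi (u : X -> R^o) : R := lim (u x @[x --> U]).
have [|x xP] := Xrefl Phi.
  split.
    move=> a u v du dv; apply: cvg_lim => //.
    by apply: cvgD; [apply: cvgZl_tmp; exact: ucvg | exact: ucvg].
  exists N => u du; have [lu _] := du.
  have opn x : (`|u x|%:E <= opnorm u)%E \/ 1 < `|x|.
    have [x1|] := leP `|x| 1; [left | by right].
    by apply: ereal_sup_ubound; exists x.
  have opn_ge0 : (0 <= opnorm u)%E.
    have [|] := opn 0; last by rewrite normr0 ltr10.
    by apply: le_trans; rewrite lee_fin.
  case opnE : (opnorm u) => [l| |]; last by rewrite opnE in opn_ge0.
    rewrite -EFinM lee_fin ler_norml.
    have ul : U [set x | `|u x| <= N * l].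
      apply: filterS UN => y /= yN.
      have [|] := opn (N^-1 *: y).
        rewrite opnE lee_fin linfZ// normrZ gtr0_norm ?invr_gt0//.
        by rewrite ler_pdivrMl.
      by rewrite normrZ gtr0_norm ?invr_gt0// ltr_pdivlMl// mulr1 ltNge yN.
    apply/andP; split.
      apply: limr_ge; first exact: ucvg.
      by apply: filterS ul => y /=; rewrite ler_norml => /andP[].
    apply: limr_le; first exact: ucvg.
    by apply: filterS ul => y /=; rewrite ler_norml => /andP[].
  by rewrite gt0_muley ?lte_fin// leey.
exists x => B cB xB GB; apply: contrapT => nBx.
have [u du [e e0 ue]] := convex_separation cB xB nBx.
suff : u x + e <= u x by lra.
rewrite -{2}(xP u du); apply: limr_ge; first exact: ucvg.
by apply: filterS (GU _ GB) => y; exact: ue.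
Qed.

Lemma norm_convex_comb (R : realType) (V : normedModType R) (x y : V)
    (a b e : R) :
  0 <= a -> 0 <= b -> a + b = 1 -> `|x| <= e -> `|y| <= e ->
  `|a *: x + b *: y| <= e.
Proof.
move=> a0 b0 ab1 xe ye; apply: le_trans (ler_normD _ _) _.
rewrite !normrZ !ger0_norm// -[leRHS]mul1r -ab1 mulrDl.
by apply: lerD; exact: ler_wpM2l.
Qed.

Lemma convex_closure (R : realType) (V : normedModType R) (A : set V) :
  convex_set (A : set (convex_lmodType V)) ->
  convex_set (closure A : set (convex_lmodType V)).
Proof.
move=> /convex_setP xA; apply/convex_setP => x y a b a0 b0 ab1.
move=> /closure_normP clx /closure_normP cly; apply/closure_normP => e e0.
have e20 : 0 < e / 2 by rewrite divr_gt0.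
have [[x' Ax' xx'] [y' Ay' yy']] := (clx _ e20, cly _ e20).
exists (a *: x' + b *: y'); first exact: xA.
rewrite opprD addrACA -!scalerBr.
apply: (@le_lt_trans _ _ (e / 2)); last by lra.
by apply: norm_convex_comb => //; exact: ltW.
Qed.

Lemma closed_norm_le (R : realType) (V : normedModType R) (m : R) :
  closed [set x : V | `|x| <= m].
Proof.
move=> x /closure_normP clx; apply/ler_addgt0Pr => e e0.
have [y /= ym xy] := clx e e0.
have := ler_normD (x - y) y; rewrite subrK; lra.
Qed.

Lemma convex_norm_le (R : realType) (V : normedModType R) (m : R) :
  convex_set ([set x : V | `|x| <= m] : set (convex_lmodType V)).
Proof. by apply/convex_setP => x y a b a0 b0 ab1; exact: norm_convex_comb. Qed.

(** Used with [S e] the minimizers, or the solutions, up to the tolerance [e]. The point that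
    [reflexive_filter_point] attaches to this filter is then an exact one. *)
Lemma filter_from_gt0 (R : realType) (T : Type) (S : R -> set T) :
  (forall d e, 0 < d -> d <= e -> S d `<=` S e) ->
  (forall e, 0 < e -> S e !=set0) ->
  ProperFilter (filter_from [set e : R | 0 < e] S).
Proof.
move=> Smono S0; apply: filter_from_proper => //.
apply: filter_from_filter; first by exists 1 => /=.
move=> d e /= d0 e0; exists (Num.min d e); first by rewrite /= lt_min d0.
move=> x Sx; split; apply: Smono Sx; rewrite ?lt_min ?d0//.
  by rewrite ge_min lexx.
by rewrite ge_min lexx orbT.
Qed.

(** The direct method: [D] and all balls of radius [m + e] are closed and convex, so they retain the
    weak limit of the near-minimizers. *)
Lemma reflexive_min_norm (R : realType) (X : normedModType R) (D : set X) :
  reflexive_space X -> D !=set0 -> closed D ->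
  convex_set (D : set (convex_lmodType X)) ->
  exists2 d, D d & forall d', D d' -> `|d| <= `|d'|.
Proof.
move=> Xrefl [d0 Dd0] cD xD.
have hi : has_inf [set `|d| | d in D].
  by split; [exists `|d0|; exists d0 | exists 0 => _ [d _ <-]].
pose m := inf [set `|d| | d in D].
pose S e := [set d | D d /\ `|d| <= m + e].
have FS : ProperFilter (filter_from [set e : R | 0 < e] S).
  apply: filter_from_gt0 => [d e _ de x [Dx xm]|e e0].
    by split=> //; apply: le_trans xm _; rewrite lerD2l.
  have [_ [d Dd <-] dm] := inf_adherent e0 hi.
  by exists d; split=> //; exact: ltW.
have [|d dP] := reflexive_filter_point (M := m + 1) Xrefl FS.
  by exists 1 => //= x [].
have Dd : D d by apply: dP => //; exists 1 => //= x [].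
exists d => // d' Dd'; apply: (@le_trans _ _ m); last first.
  by apply: ge_inf; [exact: hi.2 | exists d'].
apply/ler_addgt0Pr => e e0; apply: (dP [set x | `|x| <= m + e]).
- exact: closed_norm_le.
- exact: convex_norm_le.
- by exists e => //= x [].
Qed.


Section Feasible.
Context {R : realType} {X Y : normedModType R} (A : X -> Y) (C : set Y).
Hypotheses (lA : linear A) (cA : continuous A).
Hypotheses (cC : closed C) (xC : convex_set (C : set (convex_lmodType Y))).

Let xC' := (convex_setP C).1 xC.

Lemma convex_feasible (m e : R) (w : Y) :
  convex_set ([set d | `|d| <= m /\ exists2 w', `|w - w'| <= e & C (A d - w')]
    : set (convex_lmodType X)).
Proof.
apply/convex_setP => x y a b a0 b0 ab1 [xm [v wv Cv]] [ym [v' wv' Cv']].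
split; first exact: norm_convex_comb.
exists (a *: v + b *: v').
  rewrite -[w]scale1r -ab1 scalerDl opprD addrACA -!scalerBr.
  exact: norm_convex_comb.
rewrite (linfD lA) !(linfZ lA) opprD addrACA -!scalerBr.
exact: xC'.
Qed.

(** Solutions for right-hand sides [w'] tending to [w] need not converge in norm; a weak limit point
    [d] of them is shown to solve the problem for [w]. *)
Lemma closed_feasible_rhs (m : R) : reflexive_space X ->
  closed [set w | exists2 d, `|d| <= m & C (A d - w)].
Proof.
move=> Xrefl w /closure_normP clw.
pose S e := [set d | `|d| <= m /\ exists2 w', `|w - w'| <= e & C (A d - w')].
have FS : ProperFilter (filter_from [set e : R | 0 < e] S).
  apply: filter_from_gt0 => [d e _ de x [xm [w' ww' Cw']]|e e0].
    by split=> //; exists w' => //; exact: le_trans de.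
  have [w' [d dm Cd] ww'] := clw _ e0; exists d; split=> //.
  by exists w' => //; exact: ltW.
have [|d dP] := reflexive_filter_point (M := m) Xrefl FS.
  by exists 1 => //= x [].
exists d.
  apply: (dP [set x | `|x| <= m]);
    [exact: closed_norm_le|exact: convex_norm_le|].
  by exists 1 => //= x [].
have [M M0 AM] := continuous_linear_le lA cA.
apply: closed_normP cC _ => e e0.
have e20 : 0 < e / 2 by rewrite divr_gt0.
(* [S (e / 2)] is convex but not known to be closed, so [d] is only placed in its closure. A member
   [d'] within [e / 2 / M] of [d] moves [A d] by less than [e / 2], and [w'] accounts for the other
   half of [e]. *)
have : closure (S (e / 2)) d.
  apply: (dP (closure (S (e / 2)))); first exact: closed_closure.
    by apply: convex_closure; exact: convex_feasible.
  by exists (e / 2) => //; exact: subset_closure.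
have eM : 0 < e / 2 / M by rewrite divr_gt0.
move=> /closure_normP/(_ _ eM)[d' [_ [w' ww' Cd']] dd'].
exists (A d' - w') => //.
have -> : A d - w - (A d' - w') = - (w - w') + A (d - d').
  by rewrite (linfB lA) !opprB addrACA [- w - _]addrC addrACA addrC.
have := ler_normD (- (w - w')) (A (d - d')).
rewrite normrN => h.
have := AM (d - d'); have := dd'; rewrite ltr_pdivlMr// mulrC => h1 h2.
by apply: le_lt_trans h _; lra.
Qed.

Hypotheses (C_ne : C !=set0) (coneC : cone C).

(** [cone] speaks of positive factors only; [0] is reached by closedness, as a limit of small
    multiples of a point of [C]. *)
Lemma cone0 : C 0.
Proof.
have [c Cc] := C_ne; apply: closed_normP cC _ => e e0.
have c1 : 0 < `|c| + 1 by rewrite ltr_wpDl.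
exists ((e / (`|c| + 1)) *: c); first by apply: coneC; rewrite ?divr_gt0.
rewrite sub0r normrN normrZ gtr0_norm ?divr_gt0// mulrAC ltr_pdivrMr//.
by rewrite ltr_pM2l//; lra.
Qed.

Lemma coneD x y : C x -> C y -> C (x + y).
Proof.
move=> Cx Cy.
have -> : x + y = 2 *: (2^-1 *: x + 2^-1 *: y).
  by rewrite scalerDr !scalerA divff ?scale1r// pnatr_eq0.
apply: coneC => //; apply: xC' => //; lra.
Qed.

Lemma bounded_below_cone (u : Y -> R^o) (c0 : R) :
  linear u -> (forall c, C c -> c0 <= - u c) -> forall c, C c -> u c <= 0.
Proof.
move=> lu uc0 c Cc; rewrite leNgt; apply/negP => uc.
have c00 : c0 <= 0 by have := uc0 0 cone0; rewrite (linf0 lu) oppr0.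
(* The multiple of [c] on which [u] equals [1 - c0], so that [- u] falls below [c0]. *)
have t0 : 0 < (1 - c0) / u c by rewrite divr_gt0//; lra.
have := uc0 _ (coneC t0 Cc); rewrite (linfZ lu).
rewrite -[_ *: _]/(_ * _) divfK ?gt_eqF//; lra.
Qed.

(* Separate w from the closed convex set {A d - c : |d| <= m, c in C}. *)
Lemma feasible_dual (m : R) (w : Y) : reflexive_space X -> 0 <= m ->
  (forall (u : Y -> R^o) (nu : R), dual u -> (forall c, C c -> u c <= 0) ->
     0 <= nu -> (forall d, `|u (A d)| <= nu * `|d|) -> - u w <= m * nu) ->
  exists2 d, `|d| <= m & C (A d - w).
Proof.
move=> Xrefl m0 H; apply: contrapT => nw.
pose K := [set w | exists2 d, `|d| <= m & C (A d - w)].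
have xK : convex_set (K : set (convex_lmodType Y)).
  apply/convex_setP => x y a b a0 b0 ab1 [d dm Cd] [d' d'm Cd'].
  exists (a *: d + b *: d'); first exact: norm_convex_comb.
  by rewrite (linfD lA) !(linfZ lA) opprD addrACA -!scalerBr; exact: xC'.
have cK : closed K := closed_feasible_rhs (m := m) Xrefl.
have [u du [e e0 ue]] := convex_separation cK xK nw.
have [lu cu] := du.
have uAc d c : `|d| <= m -> C c -> u w + e <= u (A d) - u c.
  move=> dm Cc; rewrite -(linfB lu); apply: ue; exists d => //.
  by rewrite opprB addrC subrK.
have uC c : C c -> u c <= 0.
  apply: (@bounded_below_cone _ (u w + e)) => // c' Cc'.
  by have := uAc 0 c'; rewrite normr0 (linf0 lA) (linf0 lu) sub0r; exact.
have uA d : `|d| <= m -> u w + e <= u (A d).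
  by move=> dm; have := uAc d 0 dm cone0; rewrite (linf0 lu) subr0.
have [M M0 AM] := continuous_linear_le lA cA.
have [L L0 uL] := continuous_linear_le lu cu.
have uwe : u w + e <= 0.
  by have := uA 0; rewrite normr0 (linf0 lA) (linf0 lu); exact.
(* For [m = 0] there is no ball to rescale. Any bound of [u o A], here [L * M], then gives
   [- u w <= 0], against [u w + e <= 0]. *)
have [m_eq0|m_neq0] := eqVneq m 0.
  have uAL d : `|u (A d)| <= L * M * `|d|.
    apply: le_trans (uL _) _; rewrite -mulrA.
    by apply: ler_wpM2l (AM d); exact: ltW.
  by have := H u _ du uC (ltW (mulr_gt0 L0 M0)) uAL; rewrite m_eq0 mul0r; lra.
have m_gt0 : 0 < m by rewrite lt_neqAle eq_sym m_neq0.
(* The separation inequality holds at [d] and [- d] on the whole ball of radius [m], so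
   [nu = - (u w + e) / m] bounds [u o A]. For this [nu] the hypothesis reads [- u w <= - (u w + e)],
   which is absurd. *)
have mnu : m * (- (u w + e) / m) = - (u w + e) by rewrite mulrC divfK.
have nu0 : 0 <= - (u w + e) / m by rewrite divr_ge0// oppr_ge0.
suff uAnu d : `|u (A d)| <= - (u w + e) / m * `|d|.
  by have := H u _ du uC nu0 uAnu; rewrite mnu; lra.
have [->|dn0] := eqVneq d 0.
  by rewrite (linf0 lA) (linf0 lu) !normr0 mulr0.
have d_gt0 : 0 < `|d| by rewrite normr_gt0.
have md : `|(m / `|d|) *: d| <= m.
  by rewrite normrZ ger0_norm ?divr_ge0// divfK// gt_eqF.
have := uA _ md; have := uA (- ((m / `|d|) *: d)); rewrite normrN => /(_ md).
rewrite (linfN lA) (linfN lu) (linfZ lA) (linfZ lu) -[_ *: _]/(_ * _).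
set v := u (A d) => h1 h2.
rewrite -(ler_pM2l (divr_gt0 m_gt0 d_gt0)).
have -> : m / `|d| * (- (u w + e) / m * `|d|) = - (u w + e).
  by field; rewrite m_neq0 gt_eqF.
rewrite -(ger0_norm (divr_ge0 m0 (normr_ge0 d))) -normrM ler_norml.
by apply/andP; split; lra.
Qed.

End Feasible.

(** * Convex majorants and the scalar Newton iteration *)

Section OneSidedDerivative.
Context {R : realType} (r : R) (f : R -> R).
Hypothesis f_C1 : C1_in `[0, r[%classic f.

Lemma deriv_upto_is_derive (t : R) :
  0 < t < r -> is_derive t 1 f (deriv_upto r f t).
Proof.
move=> /andP[t0 tr]; set l := deriv_upto r f t.
have fl : (f s - f t) / (s - t) @[s --> within `[0, r[ t^'] --> l.
  by apply: f_C1.1 => /=; rewrite in_itv/= ltW.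
have Dt : nbhs t (`[0, r[%classic : set R).
  have : t \in `]0, r[ by rewrite in_itv/= t0.
  move=> /near_in_itvoo; apply: filterS => s.
  by rewrite /= !in_itv/= => /andP[/ltW -> ->].
have fl' : (h^-1 *: ((f \o shift t) (h *: 1) - f t)) @[h --> 0^'] --> l.
  apply/cvgrPdist_le => e e0.
  have /cvgrPdist_le/(_ e e0) := fl.
  rewrite /prop_near1 /within /= => H.
  have : \forall s \near t, s != t -> `|l - (f s - f t) / (s - t)| <= e.
    near=> s => st; have : s \in (`[0, r[%classic : set R).
      by apply/mem_set; near: s.
    by move=> /set_mem sD; move: st sD; near: s; exact: H.
  move=> /nbhs_normP[d /= d0 dP].
  apply/nbhs_normP; exists d => // h /=; rewrite sub0r normrN => hd h0.
  have /= := dP (h + t); rewrite opprD addrCA subrr addr0 normrN => /(_ hd).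
  rewrite -subr_eq0 addrK => /(_ h0).
  by rewrite [h *: 1]mulr1 -[_ *: _]/(_ * _) mulrC.
split; first by apply/cvg_ex; exists l.
exact: cvg_lim.
Unshelve. all: by end_near. Qed.

Lemma deriv_upto_continuous (b : R) :
  0 < b < r -> {within `[0, b], continuous f}.
Proof.
move=> /andP[b0 br]; apply/continuous_within_itvP => //.
have cf t : 0 < t < r -> {for t, continuous f}.
  move=> /deriv_upto_is_derive[df _].
  by apply: differentiable_continuous; apply/derivable1_diffP.
split.
- move=> t; rewrite in_itv/= => /andP[t0 tb].
  by apply: cf; rewrite t0 (lt_trans tb).
(* At [0] only the right difference quotient is at hand; [f s] is recovered as this quotient times
   [s] plus [f 0]. *)
- have r0 := lt_trans b0 br.
  have fl :
      (f s - f 0) / (s - 0) @[s --> within `[0, r[ 0^'] --> deriv_upto r f 0.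
    by apply: f_C1.1 => /=; rewrite in_itv/= lexx.
  have fr : (f s - f 0) / (s - 0) @[s --> 0^'+] --> deriv_upto r f 0.
    apply: cvg_trans fl; apply: cvg_app => A /nbhs_normP[e /= e0 Ae].
    apply/nbhs_normP; exists (Num.min e r); first by rewrite /= lt_min e0.
    move=> s; rewrite /= sub0r normrN lt_min => /andP[se sr] s0.
    apply: Ae; rewrite /= ?sub0r ?normrN ?gt_eqF//.
    by rewrite in_itv/= ltW//= (le_lt_trans (ler_norm s)).
  have : (f s - f 0) / (s - 0) * s + f 0 @[s --> 0^'+] -->
      deriv_upto r f 0 * 0 + f 0.
    apply: cvgD; last exact: cvg_cst.
    by apply: cvgM => //; apply: cvg_at_right_filter; exact: cvg_id.
  rewrite mulr0 add0r; apply: cvg_trans; apply: near_eq_cvg.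
  near=> s; have s0 : 0 < s by near: s; exact: nbhs_right_gt.
  by rewrite subr0 divfK ?subrK// gt_eqF.
- by apply: cvg_at_left_filter; apply: cf; rewrite b0.
Unshelve. all: by end_near. Qed.

End OneSidedDerivative.

(** Replaces the integration of an inequality between derivatives. Derivatives are required at
    interior points only, since [0] is an endpoint of the domain of the majorant. *)
Lemma is_derive_le_increment (R : realType) (f df g dg : R -> R) (a b : R) :
  a <= b ->
  (forall x, a < x < b -> is_derive x 1 f (df x)) ->
  (forall x, a < x < b -> is_derive x 1 g (dg x)) ->
  {within `[a, b], continuous f} -> {within `[a, b], continuous g} ->
  (forall x, a < x < b -> df x <= dg x) ->
  f b - f a <= g b - g a.
Proof.
rewrite le_eqVlt => /predU1P[->|ab] fdf gdg cf cg dfg; first by rewrite !subrr.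
have [||c] := @MVT R (g - f) (dg - df) a b ab.
- move=> x; rewrite in_itv/= => xab.
  by apply: is_deriveB; [exact: gdg | exact: fdf].
- exact: within_continuousB.
rewrite in_itv/= => cab; rewrite !fctE => h.
have : 0 <= (dg c - df c) * (b - a).
  by rewrite mulr_ge0// subr_ge0 ?dfg// ltW.
by rewrite -h; lra.
Qed.

(** * Tangent, trapezoid and slope inequalities when the derivative [g] is convex and increasing *)

Section ConvexDerivative.
Context {R : realType} (r : R) (f g : R -> R).
Hypothesis f_cont : forall b : R, 0 < b < r -> {within `[0, b], continuous f}.
Hypothesis f_derive : forall t : R, 0 < t < r -> is_derive t 1 f (g t).
Hypothesis g_convex : forall x y z : R, 0 <= x -> x < y -> y < z -> z < r ->
  (z - x) * g y <= (z - y) * g x + (y - x) * g z.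
Hypothesis g_incr : forall s t : R, 0 <= s -> s < t -> t < r -> g s < g t.

Lemma f_cont_sub (a b : R) : 0 <= a -> a <= b -> b < r ->
  {within `[a, b], continuous f}.
Proof.
move=> a0 ab br; have [b0|b0] := ltP 0 b.
  have b0r : 0 < b < r by rewrite b0.
  apply: continuous_subspaceW (f_cont b0r).
  by move=> x /=; rewrite !in_itv/= => /andP[ax ->]; rewrite (le_trans a0).
have -> : b = a by apply/eqP; rewrite eq_le ab (le_trans b0).
by rewrite set_itv1; exact: continuous_subspace1.
Qed.

Lemma f_mvt (a b : R) : 0 <= a -> a < b -> b < r ->
  exists2 c, a < c < b & f b - f a = g c * (b - a).
Proof.
move=> a0 ab br; have [||c] := @MVT R f g a b ab.
- move=> x; rewrite in_itv/= => /andP[ax xb].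
  by apply: f_derive; rewrite (le_lt_trans a0 ax) (lt_trans xb br).
- by apply: f_cont_sub => //; exact: ltW.
by rewrite in_itv/= => cab h; exists c.
Qed.

Lemma f_gt_tangent (a b : R) : 0 <= a -> a < b -> b < r ->
  g a * (b - a) < f b - f a.
Proof.
move=> a0 ab br; have [c /andP[ac cb] ->] := f_mvt a0 ab br.
by rewrite ltr_pM2r ?subr_gt0//; apply: g_incr => //; exact: lt_trans br.
Qed.

(** Convexity puts [g] below its chord over [[a, b]]. The quadratic [q] has this chord as
    derivative, and its increment is the area of the trapezoid. *)
Lemma f_le_trapezoid (a b : R) : 0 <= a -> a < b -> b < r ->
  f b - f a - g a * (b - a) <= 2^-1 * (g b - g a) * (b - a).
Proof.
move=> a0 ab br; pose m := (g b - g a) / (b - a).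
pose q : R -> R := g a \*: (id - cst a) + (m / 2) \*: ((id - cst a) ^+ 2).
have ba0 : 0 < b - a by rewrite subr_gt0.
have dq (x : R) : is_derive x 1 q (g a + m * (x - a)).
  rewrite /q; apply: is_derive_eq.
  rewrite !fctE expr1 subr0 -![_ *: _]/(_ * _) /=.
  by field.
have qE : q b - q a = g a * (b - a) + 2^-1 * (g b - g a) * (b - a).
  have qx x : q x = g a * (x - a) + m / 2 * (x - a) ^+ 2 by [].
  by rewrite !qx /m; field; rewrite gt_eqF.
have fdf (x : R) : a < x < b -> is_derive x 1 f (g x).
  move=> /andP[ax xb].
  by apply: f_derive; rewrite (le_lt_trans a0 ax) (lt_trans xb br).
have gq (x : R) : a < x < b -> g x <= g a + m * (x - a).
  move=> /andP[ax xb]; have := g_convex a0 ax xb br => h.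
  by rewrite -lerBlDl /m mulrAC ler_pdivlMr//; lra.
have cq : {within `[a, b], continuous q}.
  by apply: derivable_within_continuous => x _; case: (dq x).
have fq := is_derive_le_increment (ltW ab) fdf (fun x _ => dq x)
  (f_cont_sub a0 (ltW ab) br) cq gq.
by move: fq; rewrite qE; lra.
Qed.

Lemma g_slope_left (x y z : R) : 0 <= x -> x < y -> y < z -> z < r ->
  (g y - g x) / (y - x) <= (g z - g x) / (z - x).
Proof.
move=> x0 xy yz zr; have xz := lt_trans xy yz.
rewrite ler_pdivrMr ?subr_gt0// mulrAC ler_pdivlMr ?subr_gt0//.
by have := g_convex x0 xy yz zr; lra.
Qed.

Lemma g_slope_right (x y z : R) : 0 <= x -> x < y -> y < z -> z < r ->
  (g z - g x) / (z - x) <= (g z - g y) / (z - y).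
Proof.
move=> x0 xy yz zr; have xz := lt_trans xy yz.
rewrite ler_pdivrMr ?subr_gt0// mulrAC ler_pdivlMr ?subr_gt0//.
by have := g_convex x0 xy yz zr; lra.
Qed.

Lemma g_slope_mid (x y z : R) : 0 <= x -> x < y -> y < z -> z < r ->
  (g y - g x) / (y - x) <= (g z - g y) / (z - y).
Proof.
move=> x0 xy yz zr; apply: le_trans (g_slope_left x0 xy yz zr) _.
exact: g_slope_right.
Qed.

(** Both slopes are compared with that of the chord from [a'] to [a + s]. In use, [a'] is the
    distance of a point to [xt] and [a] a scalar bound for it. *)
Lemma g_increment_le (a' a s : R) : 0 <= a' -> a' <= a -> 0 <= s -> a + s < r ->
  g (a' + s) - g a' <= g (a + s) - g a.
Proof.
move=> a'0; rewrite le_eqVlt => /predU1P[->//|a'a].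
rewrite le_eqVlt => /predU1P[<-|s0] asr; first by rewrite !addr0 !subrr.
have h1 :
    (g (a' + s) - g a') / (a' + s - a') <= (g (a + s) - g a') / (a + s - a').
  by apply: g_slope_left => //; rewrite ?ltrDl// ltrD2r.
have h2 : (g (a + s) - g a') / (a + s - a') <= (g (a + s) - g a) / (a + s - a).
  by apply: g_slope_right => //; rewrite ltrDl.
have := le_trans h1 h2.
have -> : a' + s - a' = s by lra.
have -> : a + s - a = s by lra.
by rewrite ler_pM2r ?invr_gt0.
Qed.

Lemma g_increment_scale (a s c : R) : 0 <= a -> 0 <= s -> 0 <= c <= 1 ->
  a + s < r -> g (a + c * s) - g a <= c * (g (a + s) - g a).
Proof.
move=> a0; rewrite le_eqVlt => /predU1P[<-|s0] /andP[c0 c1] asr.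
  by rewrite mulr0 !addr0 !subrr mulr0.
move: c0; rewrite le_eqVlt => /predU1P[<-|c0].
  by rewrite mul0r addr0 subrr mul0r.
move: c1; rewrite le_eqVlt => /predU1P[->|c1]; first by rewrite !mul1r.
have cs0 : 0 < c * s by rewrite mulr_gt0.
have css : c * s < s by rewrite -[ltRHS]mul1r ltr_pM2r.
have := @g_slope_left a (a + c * s) (a + s) a0.
rewrite !ltrD2l !ltrDl => /(_ cs0 css asr).
have -> : a + c * s - a = c * s by lra.
have -> : a + s - a = s by lra.
rewrite ler_pdivrMr// => /le_trans; apply.
by rewrite mulrCA divfK// gt_eqF.
Qed.

(** Slopes of chords ending at [s] increase with their left endpoint, so their limit dominates each
    of them. *)
Lemma slope_le_left_derivative (a s : R) : 0 <= a -> a < s -> s < r ->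
  (g s - g a) / (s - a) <= left_derivative g s.
Proof.
move=> a0 as_ sr.
pose q x := (g s - g x) / (s - x).
have qmono x y : 0 <= x -> x <= y -> y < s -> q x <= q y.
  move=> x0; rewrite le_eqVlt => /predU1P[->//|xy] ys.
  exact: g_slope_right.
have cq : cvg (q x @[x --> s^'-]).
  apply: nondecreasing_at_left_is_cvgr.
    near=> x => y z; rewrite !in_itv/= => /andP[xy ys] /andP[xz zs] yz.
    apply: qmono => //; apply: ltW; apply: le_lt_trans xy.
    by near: x; apply: nbhs_left_ge; exact: le_lt_trans as_.
  (* A chord to the right of [s] bounds those to its left, whence the limit exists; [s < r] leaves
     room for it. *)
  near=> x; pose b := (s + r) / 2.
  have [sb br] : s < b /\ b < r by rewrite /b; split; lra.
  exists ((g b - g s) / (b - s)) => _ [y /= + <-].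
  rewrite in_itv/= => /andP[xy ys]; apply: g_slope_mid => //.
  apply: ltW; apply: le_lt_trans xy.
  by near: x; apply: nbhs_left_ge; exact: le_lt_trans as_.
apply: limr_ge => //; near=> x; apply: qmono => //.
by near: x; exact: nbhs_left_ge.
Unshelve. all: end_near. Qed.

Lemma left_derivative_gt0 (s : R) : 0 < s -> s < r -> 0 < left_derivative g s.
Proof.
move=> s0 sr; apply: lt_le_trans (slope_le_left_derivative (lexx 0) s0 sr).
by rewrite divr_gt0// subr_gt0// g_incr.
Qed.

(** Taking the infimum of the set where [f <= 0], and not of the zeros, makes positivity before [ts]
    immediate. A negative value at [ts] would then force an earlier zero. *)
Lemma smallest_zero : 0 < f 0 -> (exists2 s, 0 < s < r & f s = 0) ->
  exists ts, [/\ 0 < ts < r, f ts = 0 & forall s, 0 <= s < ts -> 0 < f s].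
Proof.
move=> f0 [s0 /andP[s00 s0r] fs0].
pose Z := [set s : R | 0 <= s < r /\ f s <= 0].
have Zs0 : Z s0 by rewrite /Z/= ltW// s0r fs0.
have hi : has_inf Z by split; [exists s0 | exists 0 => s [/andP[]]].
pose ts := inf Z.
have ts0 : 0 <= ts by apply: lb_le_inf; [exists s0 | move=> s [/andP[]]].
have tsr : ts < r by apply: le_lt_trans s0r; apply: ge_inf => //; exact: hi.2.
have fpos s : 0 <= s < ts -> 0 < f s.
  move=> /andP[s0' sts]; rewrite ltNge; apply/negP => fs.
  have : ts <= s.
    by apply: ge_inf; [exact: hi.2 | rewrite /Z/= s0' (lt_trans sts tsr)].
  by rewrite leNgt sts.
have fts_le0 : f ts <= 0.
  apply/ler_addgt0Pr => e e0; rewrite add0r.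
  (* For [z] in [Z] beyond [ts], [f ts <= - g c * (z - ts)], and [- g c] is below [|g 0| + 1]
     because [g] increases. *)
  have e1 : 0 < e / (`|g 0| + 1) by rewrite divr_gt0// ltr_wpDl.
  have [z [/andP[z0 zr] fz] ze] := inf_adherent e1 hi.
  have : ts <= z by apply: ge_inf; [exact: hi.2 | rewrite /Z/= z0 zr].
  rewrite le_eqVlt => /predU1P[->|tsz].
    by apply: le_trans fz _; exact: ltW.
  have [c /andP[tsc cz] fE] := f_mvt ts0 tsz zr.
  have g0c : g 0 < g c.
    by apply: g_incr (lt_trans cz zr) => //; exact: le_lt_trans tsc.
  have : - g c * (z - ts) <= e; last by lra.
  have zts : z - ts <= e / (`|g 0| + 1) by rewrite /ts; lra.
  apply: (@le_trans _ _ ((`|g 0| + 1) * (z - ts))).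
    rewrite ler_wpM2r ?subr_ge0 ?(ltW tsz)//.
    by have := ler_norm (- g 0); rewrite normrN; lra.
  by rewrite -ler_pdivlMl ?ltr_wpDl// mulrC.
have {}ts0 : 0 < ts.
  rewrite lt_neqAle ts0 andbT; apply/eqP => tsE.
  by move: fts_le0; rewrite -tsE leNgt f0.
exists ts; split=> //; first by rewrite ts0.
apply/eqP; rewrite eq_le fts_le0 leNgt; apply/negP => fts.
have [||c] := @IVT R f 0 ts 0 (ltW ts0).
- exact: f_cont_sub (ltW ts0) tsr.
- by rewrite ge_min le_max (ltW f0) fts_le0 orbT.
rewrite in_itv/= => /andP[c0]; rewrite le_eqVlt => /predU1P[->|cts] fc.
  by move: fts; rewrite fc ltxx.
by have := fpos c; rewrite c0 cts fc ltxx => /(_ isT).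
Qed.

(** * Newton's map for the scalar equation *)

Variable ts : R.
Hypotheses (ts_r : 0 < ts < r) (f_ts : f ts = 0).
Hypothesis f_gt0 : forall s : R, 0 <= s < ts -> 0 < f s.

Let ts_gt0 : 0 < ts. Proof. by case/andP: ts_r. Qed.
Let ts_lt : ts < r. Proof. by case/andP: ts_r. Qed.

Lemma g_lt0 (s : R) : 0 <= s < ts -> g s < 0.
Proof.
move=> sts; have fs := f_gt0 sts; move: sts => /andP[s0 sts].
have := f_gt_tangent s0 sts ts_lt; rewrite f_ts => h.
have {}h : g s * (ts - s) < 0 by lra.
by move: h; rewrite pmulr_llt0// subr_gt0.
Qed.

(** [g] is negative before [ts], and convexity forbids an upward jump there: [d] is so small that
    [d * g b <= (b - ts) * g ts], and the three points [ts - d], [ts], [b] then give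
    [d * g ts < 0]. *)
Lemma g_ts_le0 : g ts <= 0.
Proof.
rewrite leNgt; apply/negP => gts.
pose b := (ts + r) / 2.
have [tsb br] : ts < b /\ b < r by rewrite /b; split; have := ts_lt; lra.
have gb : 0 < g b by apply: lt_trans gts _; apply: g_incr => //; exact: ltW.
pose d := Num.min ts ((b - ts) * g ts / g b).
have d0 : 0 < d by rewrite lt_min ts_gt0 divr_gt0// mulr_gt0// subr_gt0.
have dts : d <= ts by rewrite ge_min lexx.
have : d * g b <= (b - ts) * g ts.
  by rewrite -ler_pdivlMr// ge_min lexx orbT.
have s0 : 0 <= ts - d by rewrite subr_ge0.
have sts : ts - d < ts by lra.
have := g_convex s0 sts tsb br.
have : (b - ts) * g (ts - d) < 0.
  by rewrite pmulr_rlt0 ?subr_gt0// g_lt0// s0.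
have : 0 < d * g ts by rewrite mulr_gt0.
by lra.
Qed.

Lemma g_ts_lt0 : (exists2 s, 0 < s < r & f s < 0) -> g ts < 0.
Proof.
move=> [s /andP[s0 sr] fs]; have [sts|tss|sE] := ltgtP s ts.
- by have := f_gt0 (s := s); rewrite (ltW s0) sts => /(_ isT); lra.
- have := f_gt_tangent (ltW ts_gt0) tss sr; rewrite f_ts subr0 => h.
  by have := lt_trans h fs; rewrite pmulr_llt0// subr_gt0.
- by move: fs; rewrite sE f_ts ltxx.
Qed.

Lemma newton_map_bounds (t : R) : 0 <= t < ts -> t < t - f t / g t < ts.
Proof.
move=> tts; have ft := f_gt0 tts; have gt := g_lt0 tts.
move: tts => /andP[t0 tts]; apply/andP; split.
  by rewrite ltrDl oppr_gt0 pmulr_rlt0// invr_lt0.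
have := f_gt_tangent t0 tts ts_lt; rewrite f_ts sub0r => h.
have {}h : - f t / g t < ts - t; last by lra.
by rewrite ltr_ndivrMr// mulrC.
Qed.

(** The trapezoid over [[t, ts]], with [g ts <= 0] dropped, leaves half of [- g t * (ts - t)]. *)
Lemma newton_map_half (t : R) : 0 <= t < ts ->
  ts - (t - f t / g t) <= 2^-1 * (ts - t).
Proof.
move=> tts; have gt := g_lt0 tts; move: tts => /andP[t0 tts].
have := f_le_trapezoid t0 tts ts_lt; rewrite f_ts => h.
have gts : g ts * (ts - t) <= 0.
  by rewrite mulr_le0_ge0 ?g_ts_le0// subr_ge0 ltW.
have {}h : f t / g t <= - (2^-1 * (ts - t)); last by lra.
by rewrite ler_ndivrMr//; lra.
Qed.

(** Half the slope over [[t, ts]], at most half the left derivative, is divided by [- g t], which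
    exceeds [- g ts > 0]. *)
Lemma newton_map_quadratic (t : R) : g ts < 0 -> 0 <= t < ts ->
  ts - (t - f t / g t) <=
    left_derivative g ts / (- (2 * g ts)) * (ts - t) ^+ 2.
Proof.
move=> gts tts; have gt := g_lt0 tts; move: tts => /andP[t0 tts].
have := f_le_trapezoid t0 tts ts_lt; rewrite f_ts => h.
have tst : 0 < ts - t by rewrite subr_gt0.
have := slope_le_left_derivative t0 tts ts_lt; rewrite ler_pdivrMr// => hD.
have gtts := g_incr t0 tts ts_lt.
have D0 := left_derivative_gt0 ts_gt0 ts_lt.
set D := left_derivative g ts in hD D0 *.
apply: (@le_trans _ _ (2^-1 * D * (ts - t) ^+ 2 / (- g t))).
  rewrite ler_pdivlMr ?oppr_gt0//.
  have -> : (ts - (t - f t / g t)) * - g t = - (f t + g t * (ts - t)).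
    by field; rewrite lt_eqF.
  have := ler_wpM2r (ltW tst) hD; rewrite expr2; lra.
have -> : D / - (2 * g ts) * (ts - t) ^+ 2 = 2^-1 * D * (ts - t) ^+ 2 / - g ts.
  by rewrite !invrN invfM; ring.
apply: ler_wpM2l; first by rewrite !mulr_ge0 ?sqr_ge0 ?invr_ge0 ?ltW.
by rewrite lef_pV2 ?posrE ?oppr_gt0// lerN2 ltW.
Qed.

(** Newton's equation turns the value at the new point into a linearization error, the quantity that
    majorizes the error of [F]. *)
Lemma f_newton_map (t : R) : 0 <= t < ts ->
  f (t - f t / g t) =
    f (t - f t / g t) - f t - g t * ((t - f t / g t) - t).
Proof.
move=> tts; have gt := g_lt0 tts.
have -> : g t * (t - f t / g t - t) = - f t by field; rewrite lt_eqF.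
by rewrite opprK subrK.
Qed.

Lemma newton_map_step_quadratic (t : R) : g ts < 0 -> 0 <= t < ts ->
  let t1 := t - f t / g t in
  (t1 - f t1 / g t1) - t1 <=
    left_derivative g ts / (- (2 * g ts)) * (t1 - t) ^+ 2.
Proof.
move=> gts tts /=; set t1 := t - f t / g t.
have /andP[tt1 t1ts] : t < t1 < ts by exact: newton_map_bounds.
have t1_itv : 0 <= t1 < ts.
  by rewrite t1ts andbT; case/andP: tts => t0 _; exact: le_trans (ltW tt1).
have gt1 := g_lt0 t1_itv.
have ft1 : f t1 = f t1 - f t - g t * (t1 - t) by exact: f_newton_map.
have ft1_gt0 := f_gt0 t1_itv.
move: tts => /andP[t0 tts].
have h := f_le_trapezoid t0 tt1 (lt_trans t1ts ts_lt).
have Dt : 0 < t1 - t by rewrite subr_gt0.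
have hD : (g t1 - g t) / (t1 - t) <= left_derivative g ts.
  apply: le_trans (g_slope_left t0 tt1 t1ts ts_lt) _.
  exact: slope_le_left_derivative.
have gt1ts := g_incr (le_trans t0 (ltW tt1)) t1ts ts_lt.
have D0 := left_derivative_gt0 ts_gt0 ts_lt.
set D := left_derivative g ts in hD D0 *.
rewrite ler_pdivrMr// in hD.
have {}h : f t1 <= 2^-1 * D * (t1 - t) ^+ 2.
  by have := ler_wpM2r (ltW Dt) hD; rewrite expr2; lra.
have -> : t1 - f t1 / g t1 - t1 = f t1 / (- g t1) by rewrite invrN; ring.
have -> : D / - (2 * g ts) * (t1 - t) ^+ 2 =
    2^-1 * D * (t1 - t) ^+ 2 / (- g ts).
  by rewrite !invrN invfM; ring.
apply: ler_pM => //; first exact: ltW.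
  by rewrite invr_ge0 oppr_ge0 ltW.
by rewrite lef_pV2 ?posrE ?oppr_gt0// lerN2 ltW.
Qed.

End ConvexDerivative.

(** * The Newton step in Banach spaces *)

(** If ['d F xt d - L e] lies in [C], then [u ('d F xt d) <= u (L e)], so [- u (L e) <= nu * |d|].
    [sv_norm] takes its supremum over the domain only; Robinson's condition makes the domain
    everything. *)
Lemma sv_norm_dual (R : realType) (X Y : normedModType R) (F : X -> Y)
    (C : set Y) (xt : X) (L : X -> Y) (q : R) (u : Y -> R^o) (nu : R) :
  sv_rge (Tmap F C xt) = setT -> linear L ->
  (sv_norm (sv_inv (Tmap F C xt) \o L) <= q%:E)%E ->
  linear u -> (forall c, C c -> u c <= 0) ->
  0 <= nu -> (forall d, `|u ('d F xt d)| <= nu * `|d|) ->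
  forall d, u (L d) <= nu * q * `|d|.
Proof.
move=> Robinson lL Lq lu uC nu0 unu.
have H e : `|e| <= 1 -> - u (L e) <= nu * q.
  move=> e1; apply/ler_addgt0Pr => eps eps0.
  have Se : (set_norm ((sv_inv (Tmap F C xt) \o L) e) <= q%:E)%E.
    apply: le_trans Lq; apply: ereal_sup_ubound; exists e => //; split=> //.
    have : sv_rge (Tmap F C xt) (L e) by rewrite Robinson.
    by move=> [d _ dP]; exists d.
  have eps1 : 0 < eps / (nu + 1) by rewrite divr_gt0// ltr_wpDl.
  have /ereal_inf_lt[_ [d dS <-]] :
      (set_norm ((sv_inv (Tmap F C xt) \o L) e) < (q + eps / (nu + 1))%:E)%E.
    by apply: le_lt_trans Se _; rewrite lte_fin ltrDl.
  rewrite lte_fin => dq.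
  move: dS; rewrite /= Tmap_invE => /uC; rewrite (linfB lu) => h.
  have := unu d; rewrite ler_norml => /andP[h1 _].
  have h2 : nu * `|d| <= nu * (q + eps / (nu + 1)) by rewrite ler_wpM2l// ltW.
  have h3 : nu * (eps / (nu + 1)) <= eps.
    by rewrite mulrCA ler_piMr ?ltW// ltr_pdivrMr ?ltr_wpDl//; lra.
  have h4 : u ('d F xt d) - u (L e) <= 0 := h.
  rewrite mulrDr in h2; lra.
move=> d; have [->|dn0] := eqVneq d 0.
  by rewrite (linf0 lL) (linf0 lu) normr0 mulr0.
have d0 : 0 < `|d| by rewrite normr_gt0.
(* [H] bounds [- u (L e)], hence the opposite of the normalized vector. *)
have := H (- (`|d|^-1 *: d)).
rewrite normrN normrZ gtr0_norm ?invr_gt0// mulVf ?gt_eqF// => /(_ (lexx _)).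
rewrite (linfN lL) (linfN lu) (linfZ lL) (linfZ lu) opprK.
by rewrite -[_ *: _]/(_ * _) ler_pdivrMl// mulrC.
Qed.

(** The least bound [m] of [h] is itself a bound, so [m <= nu + m * q]. Some finite bound must be
    given beforehand, as an infinite [m] would satisfy this too. *)
Lemma linear_bound_fixpoint (R : realType) (X : normedModType R) (h : X -> R)
    (nu q : R) : 0 <= q < 1 -> 0 <= nu ->
  (exists2 M, 0 <= M & forall d, `|h d| <= M * `|d|) ->
  (forall M, 0 <= M -> (forall d, `|h d| <= M * `|d|) ->
    forall d, `|h d| <= (nu + M * q) * `|d|) ->
  forall d, `|h d| <= nu / (1 - q) * `|d|.
Proof.
move=> /andP[q0 q1] nu0 [M0 M00 hM0] step d.
pose S := [set M : R | 0 <= M /\ forall d, `|h d| <= M * `|d|].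
have hi : has_inf S by split; [exists M0 | exists 0 => M []].
have m0 : 0 <= inf S by apply: lb_le_inf; [exists M0 | move=> M []].
have Sm d' : `|h d'| <= inf S * `|d'|.
  apply/ler_addgt0Pr => e e0.
  have d1 : 0 < `|d'| + 1 by rewrite ltr_wpDl.
  have e1 : 0 < e / (`|d'| + 1) by rewrite divr_gt0.
  have [M [_ hM] Me] := inf_adherent e1 hi.
  apply: le_trans (hM d') _.
  apply: (@le_trans _ _ ((inf S + e / (`|d'| + 1)) * `|d'|)).
    by apply: ler_wpM2r => //; exact: ltW.
  rewrite mulrDl lerD2l mulrAC ler_pdivrMr// ler_pM2l//; lra.
apply: le_trans (Sm d) _; apply: ler_wpM2r => //.
rewrite ler_pdivlMr ?subr_gt0//.
have : inf S <= nu + inf S * q.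
  apply: ge_inf; first exact: hi.2.
  by split; [rewrite addr_ge0 ?mulr_ge0 | exact: step].
by lra.
Qed.

Lemma is_derive_line (R : realType) (X Y : normedModType R) (F : X -> Y)
    (u : Y -> R^o) (x h : X) (k a t : R) :
  linear u -> continuous u -> differentiable F (x + (k * (t - a)) *: h) ->
  is_derive t (1 : R) (fun s : R => u (F (x + (k * (s - a)) *: h)) : R^o)
    (u ('d F (x + (k * (t - a)) *: h) (k *: h))).
Proof.
move=> lu cu; set z := x + _ => dF.
pose q s := s^-1 *: ((F \o shift z) (s *: (k *: h)) - F z).
have Fz : q @ 0^' --> 'd F z (k *: h).
  by rewrite -deriveE//; exact: diff_derivable.
pose phi (s : R) : R^o := u (F (x + (k * (s - a)) *: h)).
have uFz : (fun s : R => s^-1 *: ((phi \o shift t) (s *: 1) - u (F z))) @ 0^'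
    --> u ('d F z (k *: h)).
  have -> : (fun s : R => s^-1 *: ((phi \o shift t) (s *: 1) - u (F z))) =
      u \o q.
    apply/funext => s; rewrite /q /= (linfZ lu) (linfB lu).
    congr (_ *: (u (F _) - _)).
    rewrite /z [RHS]addrCA scalerA -scalerDl.
    by congr (_ + _ *: _); rewrite [s *: 1]mulr1; ring.
  by apply: continuous_cvg => //; exact: cu.
split; first by apply/cvg_ex; exists (u ('d F z (k *: h))).
exact: cvg_lim.
Qed.

Section NewtonStep.
Context {R : realType} {X Y : normedModType R} (F : X -> Y) (C : set Y).
Context (r : R) (f g : R -> R) (xt : X).
Hypothesis f_cont : forall b : R, 0 < b < r -> {within `[0, b], continuous f}.
Hypothesis f_derive : forall t : R, 0 < t < r -> is_derive t 1 f (g t).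
Hypothesis g_convex : forall x y z : R, 0 <= x -> x < y -> y < z -> z < r ->
  (z - x) * g y <= (z - y) * g x + (y - x) * g z.
Hypothesis g_incr : forall s t : R, 0 <= s -> s < t -> t < r -> g s < g t.
Hypothesis g0 : g 0 = -1.
Hypothesis F_diff : forall x, `|x - xt| < r -> differentiable F x.
Hypothesis Robinson : sv_rge (Tmap F C xt) = setT.
Hypothesis F_maj : forall x y : X, `|x - xt| + `|y - x| < r ->
  (sv_norm (sv_inv (Tmap F C xt) \o (fun d => ('d F y d - 'd F x d)%R))
    <= (g (`|y - x| + `|x - xt|) - g `|x - xt|)%:E)%E.

Let lind x : linear ('d F x : X -> Y). Proof. exact: linearP. Qed.

Let lindB x y : linear (fun d => 'd F y d - 'd F x d).
Proof. by move=> a v w; rewrite !(lind _ a v w) scalerBr opprD addrACA. Qed.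

(** * The majorant condition seen through one functional *)

Section Functional.
Context (u : Y -> R^o) (lu : linear u) (cu : continuous u).
Hypothesis uC : forall c, C c -> u c <= 0.

Lemma derivative_increment_dual (nu : R) : 0 <= nu ->
  (forall d, `|u ('d F xt d)| <= nu * `|d|) ->
  forall x y d, `|x - xt| + `|y - x| < r ->
  u ('d F y d - 'd F x d) <=
    nu * (g (`|y - x| + `|x - xt|) - g `|x - xt|) * `|d|.
Proof.
move=> nu0 unu x y d xyr.
exact: (sv_norm_dual Robinson (lindB x y) (F_maj xyr) lu uC nu0 unu).
Qed.

(** The fixpoint estimate for [u o 'd F xt] with [q = g b + 1], that is [g b - g 0]. *)
Lemma derivative_dual_bound (nu b : R) (x : X) : 0 <= nu -> `|x - xt| <= b ->
  b < r -> g b < 0 -> (forall d, `|u ('d F x d)| <= nu * `|d|) ->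
  forall d, `|u ('d F xt d)| <= nu / - g b * `|d|.
Proof.
move=> nu0 xb br gb unu.
have b0 : 0 <= b by exact: le_trans xb.
have r0 : 0 < r by exact: le_lt_trans br.
have gb1 : -1 <= g b.
  move: b0; rewrite -g0 le_eqVlt => /predU1P[->//|b0].
  by apply: ltW; exact: g_incr.
have -> : - g b = 1 - (g b + 1) by ring.
apply: linear_bound_fixpoint => //; first by lra.
  have [M M0 AM] : exists2 M : R, 0 < M & forall d, `|'d F xt d| <= M * `|d|.
    apply: continuous_linear_le => //; apply: diff_continuous.
    by apply: F_diff; rewrite subrr normr0.
  have [L L0 uL] := continuous_linear_le lu cu.
  exists (L * M); first by rewrite mulr_ge0 ?ltW.
  move=> d; apply: le_trans (uL _) _; rewrite -mulrA.
  by apply: ler_wpM2l (AM d); exact: ltW.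
move=> M M0 hM d.
have inc e : u ('d F x e - 'd F xt e) <= M * (g b + 1) * `|e|.
  apply: le_trans (derivative_increment_dual M0 hM _ _) _.
    by rewrite subrr normr0 add0r; exact: le_lt_trans xb br.
  rewrite subrr normr0 addr0 g0 opprK; apply: ler_wpM2r => //.
  apply: ler_wpM2l => //; rewrite lerD2r.
  move: xb; rewrite le_eqVlt => /predU1P[->//|xb].
  by apply: ltW; exact: g_incr.
have := unu d; have := inc d; have := inc (- d).
rewrite normrN !linearN -opprD (linfN lu) (linfB lu) mulrDl => h1 h2 h3.
have : `|u ('d F x d)| <= nu * `|d| by [].
rewrite !ler_norml => /andP[h4 h5].
have h6 : - (u ('d F x d) - u ('d F xt d)) <= M * (g b + 1) * `|d| by [].
have h7 : u ('d F x d) - u ('d F xt d) <= M * (g b + 1) * `|d| by [].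
by apply/andP; split; lra.
Qed.

(** The segment from [p] to [p + h] is run through by [t] in [[a, b]], so that its derivative can be
    compared with that of [f] at the same time. Of the two factors [c], one is the length of [h]
    relative to [b - a]; the other comes from [g_increment_scale], as the point [z t] has moved by
    [c * (t - a)] only. *)
Lemma linearization_error_dual (nu a b : R) (p h : X) : 0 <= nu ->
  (forall d, `|u ('d F xt d)| <= nu * `|d|) ->
  `|p - xt| <= a -> a < b -> b < r -> `|h| <= b - a ->
  u (F (p + h) - F p - 'd F p h) <=
    nu * (`|h| / (b - a)) ^+ 2 * (f b - f a - g a * (b - a)).
Proof.
move=> nu0 unu pa ab br hba.
have a0 : 0 <= a by exact: le_trans pa.
have ba0 : 0 < b - a by rewrite subr_gt0.
set c := `|h| / (b - a).
have c01 : 0 <= c <= 1 by rewrite divr_ge0 ?(ltW ba0)//= ler_pdivrMr// mul1r.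
have cba : `|h| = c * (b - a) by rewrite divfK// gt_eqF.
pose k := (b - a)^-1.
pose z t := p + (k * (t - a)) *: h.
have zp t : a <= t -> `|z t - p| = c * (t - a).
  move=> at_; rewrite /z addrAC subrr add0r normrZ ger0_norm; last first.
    by rewrite mulr_ge0 ?subr_ge0// invr_ge0 ltW.
  by rewrite /k /c; ring.
have zr t : a <= t <= b -> `|p - xt| + `|z t - p| < r.
  move=> /andP[at_ tb]; rewrite zp//; apply: le_lt_trans br.
  have : c * (t - a) <= t - a.
    by case/andP: c01 => _ c1; rewrite ler_piMl// subr_ge0.
  by lra.
have zF t : a <= t <= b -> differentiable F (z t).
  move=> atb; apply: F_diff; apply: le_lt_trans (zr t atb).
  by rewrite [leRHS]addrC; exact: ler_distD.
pose phi : R -> R := (fun t => u (F (z t))) - (fun t => k * u ('d F p h) * t).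
have dphi t : a <= t <= b ->
    is_derive t 1 phi (u ('d F (z t) (k *: h)) - k * u ('d F p h)).
  move=> atb; apply: is_deriveB; first exact: is_derive_line (zF t atb).
  have := @is_deriveZ _ _ _ id (k * u ('d F p h)) t 1 1 (is_derive_id _ _).
  by rewrite [_ *: 1]mulr1.
pose K := nu * c ^+ 2.
pose psi : R -> R := K \*: (f - (fun t => g a * t)).
have dpsi t : a < t < b -> is_derive t 1 psi (K * (g t - g a)).
  move=> /andP[at_ tb]; apply: is_deriveZ; apply: is_deriveB.
    by apply: f_derive; rewrite (le_lt_trans a0 at_) (lt_trans tb br).
  have := @is_deriveZ _ _ _ id (g a) t 1 1 (is_derive_id _ _).
  by rewrite [_ *: 1]mulr1.
have dle t : a < t < b ->
    u ('d F (z t) (k *: h)) - k * u ('d F p h) <= K * (g t - g a).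
  move=> /andP[at_ tb]; have atb : a <= t <= b by rewrite !ltW.
  have ta0 : 0 <= t - a by rewrite subr_ge0 ltW.
  have k0 : 0 < k by rewrite invr_gt0.
  have := derivative_increment_dual nu0 unu h (zr t atb).
  rewrite zp ?(ltW at_)// => inc.
  have atr : a + (t - a) < r by rewrite addrC subrK (lt_trans tb br).
  have cta0 : 0 <= c * (t - a) by rewrite mulr_ge0//; case/andP: c01.
  have catr : a + c * (t - a) < r.
    apply: le_lt_trans atr; rewrite lerD2l ler_piMl//.
    by case/andP: c01.
  have g1 := g_increment_le g_convex (normr_ge0 (p - xt)) pa cta0 catr.
  have := g_increment_scale g_convex a0 ta0 c01 atr.
  rewrite [a + (t - a)]addrC subrK => g2.
  have -> : u ('d F (z t) (k *: h)) - k * u ('d F p h) =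
      k * u ('d F (z t) h - 'd F p h).
    by rewrite linearZ/= (linfZ lu) (linfB lu) -[_ *: _]/(_ * _); ring.
  have -> : K * (g t - g a) = k * (nu * (c * (g t - g a)) * `|h|).
    by rewrite /K cba /k; field; rewrite gt_eqF.
  rewrite ler_pM2l//; apply: le_trans inc _; apply: ler_wpM2r => //.
  by apply: ler_wpM2l => //; apply: le_trans g2; rewrite [X in g X]addrC.
have cphi : {within `[a, b], continuous phi}.
  apply: derivable_within_continuous => t; rewrite in_itv/= => atb.
  by case: (dphi t atb).
have cpsi : {within `[a, b], continuous psi}.
  have : {within `[a, b], continuous (f - (fun t => g a * t))}.
    apply: within_continuousB; first exact: (f_cont_sub f_cont a0 (ltW ab) br).
    apply: derivable_within_continuous => t _.
    have [] // := @is_deriveZ _ _ _ id (g a) t 1 1 (is_derive_id _ _).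
  by move=> cf t; apply: cvgZl_tmp; exact: cf.
have dphi' t : a < t < b ->
    is_derive t 1 phi (u ('d F (z t) (k *: h)) - k * u ('d F p h)).
  by move=> /andP[at_ tb]; apply: dphi; rewrite !ltW.
have := is_derive_le_increment (ltW ab) dphi' dpsi cphi cpsi dle.
have phiE t : phi t = u (F (z t)) - k * u ('d F p h) * t by [].
have psiE t : psi t = K * (f t - g a * t) by [].
have zb : z b = p + h by rewrite /z mulVf ?scale1r// gt_eqF.
have za : z a = p by rewrite /z subrr mulr0 scale0r addr0.
rewrite !phiE !psiE zb za => h1; rewrite !(linfB lu).
have h2 : k * u ('d F p h) * b - k * u ('d F p h) * a = u ('d F p h).
  by rewrite /k; field; rewrite gt_eqF.
have h3 : K * (f b - g a * b) - K * (f a - g a * a) =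
    K * (f b - f a - g a * (b - a)) by ring.
suff : u (F (p + h)) - u (F p) - u ('d F p h) <=
    K * (f b - f a - g a * (b - a)) by [].
by rewrite -h3; lra.
Qed.

End Functional.

(** * Existence and size of the Newton step *)

Hypothesis C_closed : closed C.
Hypothesis C_convex : convex_set (C : set (convex_lmodType Y)).
Hypotheses (C_ne : C !=set0) (coneC : cone C).
Hypothesis Xrefl : reflexive_space X.

Let diff_cont x : `|x - xt| < r -> continuous ('d F x).
Proof. by move=> xr; apply: diff_continuous; exact: F_diff. Qed.

(** Robinson's condition solves the problem with the derivative at [xt]; passing to the derivative
    at [x] enlarges the solution [d0] by at most the factor [1 / - g b], whence the radius. *)
Lemma linearization_feasible (b : R) (x : X) :
  `|x - xt| <= b -> b < r -> g b < 0 -> exists d, C (F x + 'd F x d).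
Proof.
move=> xb br gb.
have : sv_rge (Tmap F C xt) (- F x) by rewrite Robinson.
move=> [d0 _ [c0 Cc0 d0E]].
have [|u nu [lu cu] uC nu0 unu|d _ Cd] := feasible_dual
  (lind x) (diff_cont (le_lt_trans xb br)) C_closed C_convex C_ne coneC
  (m := `|d0| / - g b) (w := - F x) Xrefl.
- by rewrite divr_ge0// oppr_ge0 ltW.
- have := derivative_dual_bound lu cu uC nu0 xb br gb unu d0.
  rewrite ler_norml => /andP[h _].
  have h2 := uC _ Cc0.
  have := congr1 u d0E; rewrite (linfB lu) => h3.
  have h4 : u ('d F xt d0) - u c0 = u (- F x) by [].
  have h5 : `|d0| / - g b * nu = nu / - g b * `|d0| by ring.
  by rewrite h5; lra.
- by exists d; rewrite addrC -[F x]opprK.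
Qed.

Lemma newton_argmin_neq0 (b : R) (x : X) :
  `|x - xt| <= b -> b < r -> g b < 0 -> newton_argmin F C x !=set0.
Proof.
move=> xb br gb.
have cA := diff_cont (le_lt_trans xb br).
pose D := [set d | C (F x + 'd F x d)].
have D_ne : D !=set0 := linearization_feasible xb br gb.
have [||d Dd dmin] := reflexive_min_norm Xrefl D_ne.
- move=> d /closure_normP cld; apply: (closed_normP C_closed) => e e0.
  have [M M0 AM] := continuous_linear_le (lind x) cA.
  have [d' Dd' dd'] := cld (e / M) (divr_gt0 e0 M0).
  exists (F x + 'd F x d') => //.
  rewrite opprD addrACA subrr add0r -(linfB (lind x)).
  by apply: le_lt_trans (AM _) _; rewrite mulrC -ltr_pdivlMr.
- apply/convex_setP => d d' s s' s0 s'0 ss' Dd Dd'; rewrite /D/=.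
  have -> : F x + 'd F x (s *: d + s' *: d') =
      s *: (F x + 'd F x d) + s' *: (F x + 'd F x d').
    rewrite !scalerDr addrACA -scalerDl ss' scale1r.
    by rewrite (linfD (lind x)) !(linfZ (lind x)).
  exact: (convex_setP C).1 C_convex _ _ _ _ s0 s'0 ss' Dd Dd'.
- by exists d; split.
Qed.

(** The previous linearization already lies in [C] and [C] is stable under sums, so a step that
    corrects the linearization error alone is feasible and bounds the minimal one. *)
Lemma newton_step_bound (a b : R) (p h d : X) :
  `|p - xt| <= a -> a < b -> b < r -> g b < 0 ->
  `|h| <= b - a -> `|p + h - xt| <= b ->
  C (F p + 'd F p h) -> newton_argmin F C (p + h) d ->
  `|d| <= (f b - f a - g a * (b - a)) / - g b * (`|h| / (b - a)) ^+ 2.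
Proof.
move=> pa ab br gb hba phb Cph [_ dmin].
set m := _ * _.
have a0 : 0 <= a by exact: le_trans pa.
have [|u nu [lu cu] uC nu0 unu|d' d'm Cd'] := feasible_dual
  (lind (p + h)) (diff_cont (le_lt_trans phb br)) C_closed C_convex C_ne coneC
  (m := m) (w := - (F (p + h) - F p - 'd F p h)) Xrefl.
- rewrite mulr_ge0 ?sqr_ge0// divr_ge0 ?oppr_ge0 ?(ltW gb)// subr_ge0 ltW//.
  exact: (f_gt_tangent f_cont f_derive g_incr).
- have h0 := derivative_dual_bound lu cu uC nu0 phb br gb unu.
  have nugb : 0 <= nu / - g b by rewrite divr_ge0// oppr_ge0 ltW.
  have := linearization_error_dual lu cu uC nugb h0 pa ab br hba.
  rewrite (linfN lu) opprK => /le_trans; apply.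
  by rewrite le_eqVlt; apply/orP; left; apply/eqP; rewrite /m; ring.
- apply: le_trans d'm; apply: dmin.
  have -> : F (p + h) + 'd F (p + h) d' =
      ('d F (p + h) d' - - (F (p + h) - F p - 'd F p h)) + (F p + 'd F p h).
    by rewrite opprK -(addrA (F (p + h))) -opprD -addrA subrK addrC.
  exact: coneD.
Qed.

(** * Comparison of the iterates with the scalar sequence *)

Context (ts : R) (t : nat -> R).
Hypotheses (ts_r : 0 < ts < r) (f_ts : f ts = 0).
Hypothesis f_gt0 : forall s : R, 0 <= s < ts -> 0 < f s.
Hypotheses (t0 : t 0%N = 0) (tS : forall k, t k.+1 = t k - f (t k) / g (t k)).

Lemma newton_scalar_itv k : 0 <= t k < ts.
Proof.
elim: k => [|k IH]; first by rewrite t0 lexx; case/andP: ts_r.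
have := newton_map_bounds f_cont f_derive g_incr ts_r f_ts f_gt0 IH.
rewrite -tS => /andP[tt ->]; rewrite andbT; apply: le_trans (ltW tt).
by case/andP: IH.
Qed.

Lemma newton_scalar_lt k : t k < t k.+1.
Proof.
have := newton_map_bounds f_cont f_derive g_incr ts_r f_ts f_gt0
  (newton_scalar_itv k).
by rewrite -tS => /andP[].
Qed.

Lemma newton_step_scalar_bound j (p h d : X) :
  `|p - xt| <= t j -> `|h| <= t j.+1 - t j -> C (F p + 'd F p h) ->
  newton_argmin F C (p + h) d ->
  `|d| <= (t j.+2 - t j.+1) * (`|h| / (t j.+1 - t j)) ^+ 2.
Proof.
move=> pt ht Cph dmin; have /andP[tj0 tj] := newton_scalar_itv j.
have tj1 := newton_scalar_itv j.+1.
have gtj1 := g_lt0 f_cont f_derive g_incr ts_r f_ts f_gt0 tj1.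
have tr : t j.+1 < r by case/andP: tj1 => _ /lt_trans; apply; case/andP: ts_r.
have pht : `|p + h - xt| <= t j.+1.
  by rewrite addrAC; apply: le_trans (ler_normD _ _) _; lra.
have := newton_step_bound pt (newton_scalar_lt j) tr gtj1 ht pht Cph dmin.
have := f_newton_map f_cont f_derive g_incr ts_r f_ts f_gt0
  (newton_scalar_itv j).
rewrite -tS => <-; have -> // : f (t j.+1) / - g (t j.+1) = t j.+2 - t j.+1.
by rewrite (tS j.+1) invrN; ring.
Qed.

Hypothesis init : (set_norm (sv_inv (Tmap F C xt) (- F xt)%R) <= (f 0)%:E)%E.

Lemma newton_first_step (d : X) :
  newton_argmin F C xt d -> `|d| <= t 1%N - t 0%N.
Proof.
move=> [_ dmin]; rewrite tS t0 g0 invrN1 mulrN1 opprK add0r subr0.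
apply/ler_addgt0Pr => e e0.
have /ereal_inf_lt[_ [d' d'S <-]] :
    (set_norm (sv_inv (Tmap F C xt) (- F xt)%R) < (f 0 + e)%:E)%E.
  by apply: le_lt_trans init _; rewrite lte_fin ltrDl.
rewrite lte_fin => d'e; apply: le_trans (ltW d'e); apply: dmin.
by move: d'S; rewrite Tmap_invE /= opprK addrC.
Qed.

Lemma newton_run_argmin n (x : nat -> X) k :
  newton_run F C xt n x -> (k < n)%N ->
  newton_argmin F C (x k) (x k.+1 - x k).
Proof. by move=> [_ xr] /xr[d dm ->]; rewrite addrC addKr. Qed.

(** Finite runs are treated because well-definedness concerns every partial choice of minimizers.
    The first step is bounded by [init], each later one by its predecessor. *)
Lemma newton_run_bounds n (x : nat -> X) k :
  newton_run F C xt n x -> (k <= n)%N ->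
  (forall j, (j <= k)%N -> `|x j - xt| <= t j) /\
  (forall j, (j < k)%N -> `|x j.+1 - x j| <= t j.+1 - t j).
Proof.
move=> xr; have x0 := xr.1.
elim: k => [|k IH] kn.
  by split=> // j; rewrite leqn0 => /eqP ->; rewrite x0 subrr normr0 t0.
have [xj xj1] := IH (ltnW kn).
have xkS : `|x k.+1 - x k| <= t k.+1 - t k.
  case: k {IH} kn xj xj1 => [|k] kn xj xj1.
    by apply: newton_first_step; have := newton_run_argmin xr kn; rewrite x0.
  have xkS := xj1 k (ltnSn k).
  have [Ck _] := newton_run_argmin xr (ltnW kn).
  have := newton_step_scalar_bound (xj k (leqnSn k)) xkS Ck.
  rewrite [x k + _]addrC subrK => /(_ _ (newton_run_argmin xr kn)) h.
  apply: le_trans h _; rewrite ler_piMr//.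
    by rewrite subr_ge0 ltW// newton_scalar_lt.
  have tk : 0 < t k.+1 - t k by rewrite subr_gt0 newton_scalar_lt.
  by rewrite expr_le1// ?divr_ge0 ?(ltW tk)// ler_pdivrMr// mul1r.
split=> j.
  rewrite leq_eqVlt => /predU1P[->|]; last exact: xj.
  have := xj k (leqnn k); have := ler_distD (x k) (x k.+1) xt; lra.
by rewrite ltnS leq_eqVlt => /predU1P[->//|]; exact: xj1.
Qed.

Lemma newton_run_quadratic n (x : nat -> X) k :
  newton_run F C xt n x -> (k.+1 < n)%N ->
  `|x k.+2 - x k.+1| <=
    (t k.+2 - t k.+1) / (t k.+1 - t k) ^+ 2 * `|x k.+1 - x k| ^+ 2.
Proof.
move=> xr kn; have [xj xj1] := newton_run_bounds xr (ltnW kn).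
have [Ck _] := newton_run_argmin xr (ltnW kn).
have := newton_step_scalar_bound (xj k (leqnSn k)) (xj1 k (ltnSn k)) Ck.
rewrite [x k + _]addrC subrK => /(_ _ (newton_run_argmin xr kn)).
by rewrite expr_div_n mulrA mulrAC.
Qed.

End NewtonStep.

(** * Convergence *)

Lemma halving_cvg0 (R : realType) (e : nat -> R) :
  (forall k, 0 <= e k) -> (forall k, e k.+1 <= 2^-1 * e k) ->
  e k @[k --> \oo] --> 0.
Proof.
move=> e0 eS.
have ele k : e k <= geometric (e 0%N) 2^-1 k.
  elim: k => [|k IH]; first by rewrite /= expr0 mulr1.
  apply: le_trans (eS k) _; rewrite /= exprS mulrCA.
  by rewrite ler_pM2l// invr_gt0.
have gcvg : geometric (e 0%N) (2^-1 : R) @ \oo --> 0.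
  by apply: cvg_geometric; rewrite ger0_norm ?invr_ge0// invf_lt1// ltr1n.
apply: (squeeze_cvgr _ (cvg_cst 0) gcvg).
by near=> k; rewrite e0 ele.
Unshelve. all: by end_near. Qed.

Lemma halving_Q_linear (R : realType) (V : normedModType R) (u : nat -> V)
    (l : V) :
  (forall k, `|l - u k.+1| <= 2^-1 * `|l - u k|) -> Q_linear u l.
Proof.
move=> uS; split.
  apply/cvgrPdist_lt => e e0.
  have h := halving_cvg0 (fun k => normr_ge0 (l - u k)) uS.
  have /cvgrPdist_lt/(_ e e0) := h.
  by apply: filterS => k; rewrite sub0r normrN normr_id.
exists 2^-1; last exact: nearW.
by rewrite invr_gt0 ltr0n invf_lt1// ltr1n.
Qed.

Section Majorized.
Context {R : realType} {X : completeNormedModType R}.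
Context (x : nat -> X) (t : nat -> R) (ts : R).
Hypothesis xt : forall k, `|x k.+1 - x k| <= t k.+1 - t k.
Hypothesis t_le : forall k, t k <= ts.

Lemma majorized_dist k n : `|x (k + n)%N - x k| <= t (k + n)%N - t k.
Proof.
elim: n => [|n IH]; first by rewrite addn0 !subrr normr0.
rewrite addnS; have := ler_distD (x (k + n)%N) (x (k + n).+1) (x k).
have := xt (k + n)%N; lra.
Qed.

Lemma majorized_cvg : t k @[k --> \oo] --> ts ->
  exists2 xs, x k @[k --> \oo] --> xs & forall k, `|xs - x k| <= ts - t k.
Proof.
move=> tts.
have : cvg (x k @[k --> \oo]).
  apply: cauchy_cvg; apply: cauchy_exP => e e0.
  have /cvgrPdist_lt/(_ e e0)[N _ NP] := tts.
  exists (x N); exists N => // n /= Nn.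
  have := NP N (leqnn N); rewrite /= => tN.
  rewrite -ball_normE /= distrC; have := majorized_dist N (n - N).
  rewrite subnKC// => h; apply: le_lt_trans h _.
  have := t_le n; have := ler_norm (ts - t N); lra.
move=> /cvg_ex[/= xs xxs]; exists xs => // k.
have xk : (x n - x k) @[n --> \oo] --> xs - x k.
  by apply: cvgB => //; exact: cvg_cst.
apply: (@closed_cvg _ _ _ _ _ [set y : X | `|y| <= ts - t k] _ _ _ xk).
  exact: closed_norm_le.
exists k => // n /= kn; have := majorized_dist k (n - k).
by rewrite subnKC//; have := t_le n; lra.
Qed.

End Majorized.

(** * From quadratic bounds on steps to quadratic bounds on errors *)

Section QuadraticLimsup.
Context {R : realType} {X : normedModType R} (x : nat -> X) (xs : X).
Context (K : R) (tau : nat -> R).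
Hypotheses (K0 : 0 <= K) (x_xs : x k @[k --> \oo] --> xs).
Hypothesis xK : forall k, `|x k.+2 - x k.+1| <= K * `|x k.+1 - x k| ^+ 2.
Hypothesis x_tau : forall k, `|x k.+1 - x k| <= tau k.
Hypothesis tau_nincr : forall k, tau k.+1 <= tau k.

Let step_le k : `|x k.+2 - x k.+1| <= K * tau k * `|x k.+1 - x k|.
Proof.
apply: le_trans (xK k) _; rewrite expr2 mulrA; apply: ler_wpM2r => //.
exact: ler_wpM2l.
Qed.

(** From [k] on the steps shrink at least by the factor [K * tau k]; the bound is the sum of that
    geometric series. *)
Lemma quadratic_tail k : K * tau k < 1 ->
  `|xs - x k| <= `|x k.+1 - x k| / (1 - K * tau k).
Proof.
move=> kt; have tail n : forall j, K * tau j < 1 ->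
    `|x (j + n)%N - x j| <= `|x j.+1 - x j| / (1 - K * tau j).
  elim: n => [|n IH] j j1.
    by rewrite addn0 subrr normr0 divr_ge0// subr_ge0 ltW.
  have jS : K * tau j.+1 <= K * tau j by exact: ler_wpM2l.
  have := IH j.+1 (le_lt_trans jS j1); rewrite addSnnS => h.
  have d0 : 0 < 1 - K * tau j by rewrite subr_gt0.
  apply: le_trans (ler_distD (x j.+1) _ _) _.
  have h1 : `|x j.+2 - x j.+1| / (1 - K * tau j.+1) <=
      K * tau j * `|x j.+1 - x j| / (1 - K * tau j).
    apply: ler_pM => //; first by rewrite invr_ge0; lra.
    by rewrite lef_pV2 ?posrE; lra.
  have h2 : K * tau j * `|x j.+1 - x j| / (1 - K * tau j) + `|x j.+1 - x j| =
      `|x j.+1 - x j| / (1 - K * tau j) by field; rewrite gt_eqF.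
  by lra.
have xk : (x n - x k) @[n --> \oo] --> xs - x k.
  by apply: cvgB => //; exact: cvg_cst.
apply: (@closed_cvg _ _ _ _ _
  [set y : X | `|y| <= `|x k.+1 - x k| / (1 - K * tau k)] _ _ _ xk).
  exact: closed_norm_le.
by exists k => // n /= kn; have := tail (n - k)%N k kt; rewrite subnKC.
Qed.

(** The tail bound at [k.+1] gives [K e^2 / (1 - d)] with [e] the step. Since [e] is at most the sum
    of two consecutive errors, and the second is at most [d e / (1 - d)], [e] is at most
    [(1 - d) / (1 - 2 d)] times the first. All corrections tend to [1] with [d], so no constant is
    lost in the limit. *)
Lemma quadratic_error k : K * tau k < 2^-1 ->
  `|xs - x k.+1| <=
    K * (1 - K * tau k) / (1 - 2 * (K * tau k)) ^+ 2 * `|xs - x k| ^+ 2.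
Proof.
set d := K * tau k => d2.
have tau0 : 0 <= tau k by exact: le_trans (x_tau k).
have d0 : 0 <= d by rewrite mulr_ge0.
have d1 : 0 < 1 - d by lra.
have d3 : 0 < 1 - 2 * d by lra.
have dS : K * tau k.+1 <= d by exact: ler_wpM2l.
set e := `|x k.+1 - x k|.
have h1 : `|xs - x k.+1| <= K * e ^+ 2 / (1 - d).
  apply: le_trans (quadratic_tail _) _; first by lra.
  apply: ler_pM => //; first by rewrite invr_ge0; lra.
  by rewrite lef_pV2 ?posrE; lra.
have h2 : K * e ^+ 2 <= d * e.
  rewrite expr2 mulrA; apply: ler_wpM2r; first exact: normr_ge0.
  by rewrite /d /e; apply: ler_wpM2l.
have h3 : e <= `|xs - x k| + `|xs - x k.+1|.
  by have := ler_distD xs (x k.+1) (x k); rewrite (distrC _ xs) -/e addrC.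
have h4 : e * (1 - 2 * d) <= `|xs - x k| * (1 - d).
  have : `|xs - x k.+1| * (1 - d) <= d * e.
    by rewrite -ler_pdivlMr//; apply: le_trans h1 _; rewrite ler_pM2r ?invr_gt0.
  have : e * (1 - d) <= (`|xs - x k| + `|xs - x k.+1|) * (1 - d).
    by rewrite ler_pM2r.
  lra.
have h5 : e <= `|xs - x k| * ((1 - d) / (1 - 2 * d)).
  by rewrite mulrA ler_pdivlMr.
apply: le_trans h1 _.
have -> : K * (1 - d) / (1 - 2 * d) ^+ 2 * `|xs - x k| ^+ 2 =
    K * (`|xs - x k| * ((1 - d) / (1 - 2 * d))) ^+ 2 / (1 - d).
  by field; rewrite !gt_eqF.
rewrite ler_pM2r ?invr_gt0//; apply: ler_wpM2l => //.
have e0 : 0 <= e by exact: normr_ge0.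
by rewrite lerXn2r// nnegrE (le_trans e0 h5).
Qed.

Lemma quadratic_limsup : tau k @[k --> \oo] --> 0 ->
  (limn_esup (fun k => `|xs - x k.+1|%:E / (`|xs - x k| ^+ 2)%R%:E) <= K%:E)%E.
Proof.
move=> tau0.
have dcvg : K * tau k @[k --> \oo] --> 0.
  by rewrite -(mulr0 K); apply: cvgM => //; exact: cvg_cst.
have vcvg : K * (1 - K * tau k) / (1 - 2 * (K * tau k)) ^+ 2 @[k --> \oo] --> K.
  have c1 : K * (1 - K * tau k) @[k --> \oo] --> K * (1 - 0).
    by apply: cvgM; [exact: cvg_cst | apply: cvgB => //; exact: cvg_cst].
  have c2 : (1 - 2 * (K * tau k)) ^+ 2 @[k --> \oo] --> ((1 - 2 * 0) ^+ 2 : R).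
    rewrite !expr2.
    have c3 : 1 - 2 * (K * tau k) @[k --> \oo] --> (1 - 2 * 0 : R).
      by apply: cvgB; [exact: cvg_cst | apply: cvgM => //; exact: cvg_cst].
    by apply: cvgM.
  have : K * (1 - K * tau k) / (1 - 2 * (K * tau k)) ^+ 2 @[k --> \oo] -->
      (K * (1 - 0) / (1 - 2 * 0) ^+ 2 : R).
    apply: cvgM => //; apply: cvgV => //.
  by rewrite mulr0 !subr0 mulr1 expr1n divr1.
apply/lee_addgt0Pr => e e0.
have half0 : (0 : R) < 2^-1 by rewrite invr_gt0.
have /cvgrPdist_lt/(_ e e0) near2 := vcvg.
have near1 : \forall k \near \oo, K * tau k < 2^-1.
  by move: dcvg => /cvgr_lt; apply.
have [N _ NP] := filterI near1 near2.
(* The limsup is an infimum over sets of the filter; the tail from [N] on suffices. *)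
apply: ge_ereal_inf.
exists (ereal_sup ((fun k => `|xs - x k.+1|%:E / (`|xs - x k| ^+ 2)%R%:E)%E @`
  [set k | (N <= k)%N])).
  by exists [set k | (N <= k)%N] => //; exists N.
apply: ge_ereal_sup => _ [k /= /NP[/= h1 h2] <-].
have h := quadratic_error h1.
have [E0|E0] := eqVneq `|xs - x k| 0.
  (* A zero denominator forces a zero numerator, and the product with [0] is [0] in the extended
     reals. *)
  move: h; rewrite E0 expr0n mulr0 => h.
  have -> : `|xs - x k.+1| = 0 by apply/eqP; rewrite eq_le h/=.
  by rewrite mul0e -EFinD lee_fin addr_ge0// ltW.
have Epos : 0 < `|xs - x k| ^+ 2 by rewrite exprn_gt0// lt_neqAle eq_sym E0/=.
rewrite inver gt_eqF// -EFinM -EFinD lee_fin ler_pdivrMr//.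
apply: le_trans h _; rewrite ler_pM2r//.
by have := ler_norm (K * (1 - K * tau k) / (1 - 2 * (K * tau k)) ^+ 2 - K);
  rewrite distrC => h3; lra.
Qed.

End QuadraticLimsup.

Lemma opnorm_le (R : realType) (X Y : normedModType R) (A : X -> Y) (c : R)
    (d : X) :
  linear A -> (opnorm A <= c%:E)%E -> `|A d| <= c * `|d|.
Proof.
move=> lA Ac; have [->|dn0] := eqVneq d 0.
  by rewrite (linf0 lA) !normr0 mulr0.
have d0 : 0 < `|d| by rewrite normr_gt0.
have : (`|A (`|d|^-1 *: d)|%:E <= c%:E)%E.
  apply: le_trans Ac; apply: ereal_sup_ubound; exists (`|d|^-1 *: d) => //=.
  by rewrite normrZ gtr0_norm ?invr_gt0// mulVf// gt_eqF.
by rewrite lee_fin (linfZ lA) normrZ gtr0_norm ?invr_gt0// ler_pdivrMl// mulrC.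
Qed.

Lemma convex_function_three_points (R : realType) (r : R) (g : R -> R) :
  convex_function (`[0, r[%classic : set R) g ->
  forall x y z : R, 0 <= x -> x < y -> y < z -> z < r ->
  (z - x) * g y <= (z - y) * g x + (y - x) * g z.
Proof.
move=> gc x y z x0 xy yz zr; have xz := lt_trans xy yz.
have zx0 : 0 < z - x by rewrite subr_gt0.
have s0 : 0 <= (z - y) / (z - x) by rewrite divr_ge0 ?ltW ?subr_gt0.
have s1 : (z - y) / (z - x) <= 1.
  by rewrite ler_pdivrMr// mul1r lerD2l lerN2 ltW.
have xD : x \in (`[0, r[%classic : set R).
  by rewrite inE/= in_itv/= x0 (lt_trans xz).
have zD : z \in (`[0, r[%classic : set R).
  by rewrite inE/= in_itv/= zr (ltW (le_lt_trans x0 xz)).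
set s := (z - y) / (z - x) in s0 s1.
have : g (s * x + (1 - s) * z) <= s * g x + (1 - s) * g z.
  exact: (gc (Itv01 s0 s1) x z xD zD).
have -> : s * x + (1 - s) * z = y by rewrite /s; field; rewrite gt_eqF.
rewrite -(ler_pM2l zx0).
have -> : (z - x) * (s * g x + (1 - s) * g z) = (z - y) * g x + (y - x) * g z.
  by rewrite /s; field; rewrite gt_eqF.
by [].
Qed.

(* x k.+1 - x k --> 0 and the derivatives at x k are bounded, so the
   values of the linearizations, which lie in C, converge to F xs. *)
Lemma newton_limit_feasible (R : realType) (X Y : normedModType R)
    (F : X -> Y) (C : set Y) (x : nat -> X) (xs : X) :
  closed C -> differentiable F xs ->
  opnorm (fun d => 'd F y d - 'd F xs d) @[y --> xs] --> 0%E ->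
  (forall k, C (F (x k) + 'd F (x k) (x k.+1 - x k))) ->
  x k @[k --> \oo] --> xs -> C (F xs).
Proof.
move=> cC dF dFc xC xxs.
have lind z : linear ('d F z : X -> Y) by exact: linearP.
have [M M0 AM] := continuous_linear_le (lind xs) (diff_continuous dF).
have Fx : F (x k) @[k --> \oo] --> F xs.
  by apply: continuous_cvg => //; exact: differentiable_continuous.
have dx : (x k.+1 - x k) @[k --> \oo] --> (0 : X).
  rewrite -(subrr xs); apply: cvgB => //.
  by rewrite (_ : (fun k => x k.+1) = [sequence x n.+1]_n)// cvg_shiftS.
have op1 : \forall k \near \oo,
    (opnorm (fun d => ('d F (x k) d - 'd F xs d)%R) < 1%:E)%E.
  apply: (xxs [set y | (opnorm (fun d => ('d F y d - 'd F xs d)%R) < 1%:E)%E]).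
  apply: (dFc [set z | (z < 1%:E)%E]).
  apply: open_nbhs_nbhs; split; first exact: open_ereal_lt_ereal.
  by rewrite /= lte_fin.
apply: closed_normP cC _ => e e0.
have e20 : 0 < e / 2 by rewrite divr_gt0.
(* Near [xs] the derivative differs from that at [xs] by less than [1] in norm, hence the bound
   [M + 1]. *)
have M1 : 0 < e / 2 / (M + 1) by rewrite !divr_gt0// addr_gt0.
have /cvgrPdist_lt/(_ _ e20) near1 := Fx.
have /cvgrPdist_lt/(_ _ M1) near2 := dx.
have [k [[h1 h2] h3]] := filter_ex (filterI (filterI near1 near2) op1).
exists (F (x k) + 'd F (x k) (x k.+1 - x k)) => //.
set d := x k.+1 - x k in h2 *.
have lD : linear (fun d => 'd F (x k) d - 'd F xs d).
  by move=> a v w; rewrite !(lind _ a v w) scalerBr opprD addrACA.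
have := opnorm_le d lD (ltW h3); rewrite mul1r => h4.
have h5 := AM d.
move: h2; rewrite sub0r normrN ltr_pdivlMr ?addr_gt0// => h2.
have h6 : `|'d F (x k) d| <= (M + 1) * `|d|.
  have := ler_normD ('d F (x k) d - 'd F xs d) ('d F xs d).
  by rewrite subrK; lra.
rewrite opprD addrA; apply: le_lt_trans (ler_normB _ _) _.
by have h7 : `|F xs - F (x k)| < e / 2 := h1; lra.
Qed.

Theorem theorem7 (R : realType) (X Y : completeNormedModType R)
    (Xrefl : reflexive_space X)
    (Omega : set X) (Omega_open : open Omega)
    (F : X -> Y) (F_C1 : C1_Frechet Omega F)
    (C : set Y) (C_ne : C !=set0) (C_closed : closed C)
    (C_convex : convex_set (C : set (convex_lmodType Y))) (C_cone : cone C)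
    (r : R) (r_gt0 : 0 < r) (f : R -> R) (f_C1 : C1_in `[0, r[%classic f)
    (xt : X) (xt_Omega : Omega xt)
    (Robinson : sv_rge (Tmap F C xt) = setT)
    (f_maj : majorant Omega F C r f xt)
    (init : (set_norm (sv_inv (Tmap F C xt) (- F xt)%R) <= (f 0)%:E)%E) :
  let f' := deriv_upto r f in
  let t := newton_t r f in
  exists ts : R,
  let K := left_derivative f' ts / (- (2 * f' ts)) in
  [/\ 0 < ts < r, f ts = 0 &
      forall s, s \in `[0, r[ -> f s = 0 -> ts <= s] /\
  newton_well_defined Omega F C xt /\
  (forall k, (t k \in `[0, r[) /\ f' (t k) != 0) /\
  [/\ forall i j : nat, (i < j)%N -> t i < t j,
      forall k, 0 <= t k < ts,
      t k @[k --> \oo] --> ts,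
      forall k, ts - t k.+1 <= 2^-1 * (ts - t k) &
      Q_linear (t : nat -> R^o) ts] /\
  ((exists2 s, 0 < s < r & f s < 0) ->
    (forall k, t k.+2 - t k.+1 <= K * (t k.+1 - t k) ^+ 2) /\
    (forall k, ts - t k.+1 <= K * (ts - t k) ^+ 2)) /\
  forall x : nat -> X, newton_seq F C xt x ->
  [/\ forall k, ball xt ts (x k),
      forall k, `|x k.+1 - x k| <= t k.+1 - t k &
      forall k, `|x k.+2 - x k.+1| <=
        (t k.+2 - t k.+1) / (t k.+1 - t k) ^+ 2 * `|x k.+1 - x k| ^+ 2] /\
  exists xs : X,
  [/\ x k @[k --> \oo] --> xs,
      closed_ball xt ts xs,
      C (F xs),
      forall k, `|xs - x k| <= ts - t k &
      R_linear x xs] /\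
  ((exists2 s, 0 < s < r & f s < 0) ->
    (forall k, `|x k.+2 - x k.+1| <= K * `|x k.+1 - x k| ^+ 2) /\
    (limn_esup (fun k => `|xs - x k.+1|%:E / (`|xs - x k| ^+ 2)%R%:E)
      <= K%:E)%E).
Proof.
move=> f' t.
case: f_maj => -[_ ballO maj] [[f0 f'0] [f'cvx f'incr] f_zero].
pose g := f'.
have f_cont (b : R) : 0 < b < r -> {within `[0, b], continuous f}.
  exact: deriv_upto_continuous.
have f_derive (s : R) : 0 < s < r -> is_derive s 1 f (g s).
  exact: deriv_upto_is_derive.
have g_convex := convex_function_three_points f'cvx.
have g_incr (s s' : R) : 0 <= s -> s < s' -> s' < r -> g s < g s'.
  move=> s0 ss' s'r; apply: f'incr => //.
    by rewrite in_itv/= s0 (lt_trans ss').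
  by rewrite in_itv/= s'r (ltW (le_lt_trans s0 ss')).
have [ts [ts_r f_ts f_gt0]] := smallest_zero f_cont f_derive g_incr f0 f_zero.
have /andP[ts0 tsr] := ts_r.
have ballE (x : X) (e : R) : ball xt e x <-> `|x - xt| < e.
  by rewrite -ball_normE /= distrC.
have F_diff (x : X) : `|x - xt| < r -> differentiable F x.
  by move=> xr; have [] := F_C1 _ (ballO _ ((ballE _ _).2 xr)).
have F_maj (x y : X) : `|x - xt| + `|y - x| < r ->
    (sv_norm (sv_inv (Tmap F C xt) \o (fun d => ('d F y d - 'd F x d)%R))
      <= (g (`|y - x| + `|x - xt|) - g `|x - xt|)%:E)%E.
  move=> xyr; apply: maj => //; apply/ballE.
    by apply: le_lt_trans xyr; rewrite lerDl.
  by apply: le_lt_trans xyr; rewrite [leRHS]addrC; exact: ler_distD.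
have t0 : t 0%N = 0 by [].
have tS k : t k.+1 = t k - f (t k) / g (t k) by rewrite /t /newton_t iterS.
have t_itv := newton_scalar_itv f_cont f_derive g_incr ts_r f_ts f_gt0 t0 tS.
have t_lt := newton_scalar_lt f_cont f_derive g_incr ts_r f_ts f_gt0 t0 tS.
have t_le k : t k <= ts by case/andP: (t_itv k) => _ /ltW.
have t_ge0 k : 0 <= t k by case/andP: (t_itv k).
have gt k : g (t k) < 0.
  exact: (g_lt0 f_cont f_derive g_incr ts_r f_ts f_gt0 (t_itv k)).
have half k : ts - t k.+1 <= 2^-1 * (ts - t k).
  rewrite tS.
  exact: (newton_map_half f_cont f_derive g_convex g_incr ts_r f_ts f_gt0
    (t_itv k)).
have tQ : Q_linear (t : nat -> R^o) ts.
  apply: halving_Q_linear => k.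
  by rewrite !ger0_norm ?subr_ge0.
have t_cvg : t k @[k --> \oo] --> ts := tQ.1.
have run_bounds n x k := newton_run_bounds f_cont f_derive g_convex g_incr f'0
  F_diff Robinson F_maj C_closed C_convex C_ne C_cone Xrefl ts_r f_ts f_gt0
  t0 tS init (n := n) (x := x) (k := k).
have run_quad n x k := newton_run_quadratic f_cont f_derive g_convex g_incr f'0
  F_diff Robinson F_maj C_closed C_convex C_ne C_cone Xrefl ts_r f_ts f_gt0
  t0 tS init (n := n) (x := x) (k := k).
exists ts => K; split.
  split=> // s; rewrite in_itv/= => /andP[s0 sr] fs.
  rewrite leNgt; apply/negP => sts.
  by have := f_gt0 s; rewrite s0 sts fs ltxx => /(_ isT).
split.
  move=> n x xr; have [xn _] := run_bounds n x n xr (leqnn n).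
  have xnt := xn n (leqnn n).
  have tr : t n < r by exact: le_lt_trans (t_le n) tsr.
  split; first by apply: ballO; apply/ballE; exact: le_lt_trans xnt tr.
  exact: (newton_argmin_neq0 g_incr f'0 F_diff Robinson F_maj C_closed C_convex
    C_ne C_cone Xrefl xnt tr (gt n)).
split.
  move=> k; split; last by rewrite lt_eqF// gt.
  by rewrite in_itv/= t_ge0 (le_lt_trans (t_le k) tsr).
split.
  split=> //.
  move=> i j; apply: (homo_ltn (r := fun a b : R => is_true (a < b))) => //.
  by move=> b a c; exact: lt_trans.
have t_quad : (exists2 s, 0 < s < r & f s < 0) ->
    [/\ 0 <= K, forall k, t k.+2 - t k.+1 <= K * (t k.+1 - t k) ^+ 2 &
    forall k, ts - t k.+1 <= K * (ts - t k) ^+ 2].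
  move=> fneg; have gts := g_ts_lt0 f_cont f_derive g_incr ts_r f_ts f_gt0 fneg.
  split.
  - rewrite divr_ge0//; last by rewrite oppr_ge0 pmulr_rle0// ltW.
    by apply: ltW; exact: (left_derivative_gt0 g_convex g_incr ts0 tsr).
  - move=> k; rewrite (tS k.+1) (tS k).
    exact: (newton_map_step_quadratic f_cont f_derive g_convex g_incr ts_r f_ts
      f_gt0 gts (t_itv k)).
  - move=> k; rewrite (tS k).
    exact: (newton_map_quadratic f_cont f_derive g_convex g_incr ts_r f_ts
      f_gt0 gts (t_itv k)).
split; first by move=> /t_quad[].
move=> x xseq.
have xr n : newton_run F C xt n x.
  by case: xseq => x0 xS; split=> // k _; exact: xS.
have xt_le k : `|x k - xt| <= t k.
  by have [xk _] := run_bounds k x k (xr k) (leqnn k); exact: xk.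
have xstep k : `|x k.+1 - x k| <= t k.+1 - t k.
  by have [_ xk] := run_bounds k.+1 x k.+1 (xr _) (leqnn _); exact: xk.
have xquad k : `|x k.+2 - x k.+1| <=
    (t k.+2 - t k.+1) / (t k.+1 - t k) ^+ 2 * `|x k.+1 - x k| ^+ 2.
  exact: (run_quad k.+2 x k (xr _) (ltnSn _)).
split.
  split=> // k; apply/ballE; apply: le_lt_trans (xt_le k) _.
  by case/andP: (t_itv k).
have [xs xxs xs_le] := majorized_cvg xstep t_le t_cvg.
have xs_ts : `|xs - xt| <= ts.
  by have := xs_le 0%N; rewrite (xr 0%N).1 t0 subr0.
exists xs; split.
  split=> //.
  - by rewrite closed_ballE//= /closed_ball_/= distrC.
  - have xsr : `|xs - xt| < r by exact: le_lt_trans tsr.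
    have [_ dFc] := F_C1 _ (ballO _ ((ballE _ _).2 xsr)).
    apply: (newton_limit_feasible C_closed (F_diff _ xsr) dFc _ xxs) => k.
    by have [] := newton_run_argmin (xr k.+1) (ltnSn k).
  - exists (fun k => ts - t k) => //.
    apply: halving_Q_linear => k.
    by rewrite !sub0r !normrN !ger0_norm ?subr_ge0.
move=> /t_quad[K0 tK _].
have xK k : `|x k.+2 - x k.+1| <= K * `|x k.+1 - x k| ^+ 2.
  apply: le_trans (xquad k) _; apply: ler_wpM2r; first exact: sqr_ge0.
  by rewrite ler_pdivrMr ?exprn_gt0 ?subr_gt0.
split=> //.
(* The remaining distance [ts - t k] dominates the step [t k.+1 - t k], decreases and tends to
   [0]. *)
apply: (quadratic_limsup (tau := fun k => ts - t k)) => //.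
- by move=> k; apply: le_trans (xstep k) _; rewrite lerD2r.
- by move=> k; rewrite lerD2l lerN2 ltW.
- by rewrite -(subrr ts); apply: cvgB => //; exact: cvg_cst.
Qed.
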